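(* Let $E=\mathbb{R}^{3\times 3}_{\rm sym}$, $F=E^*$, let $T>0$ be a fixed time horizon, and let $\mathbb{C}\in L(E,F)$ and a measurable hereditary kernel $\mathbb{K}:\mathbb{R}\to L(E,F)$ satisfy the standing assumptions stated in the context. Assume: (i) (Elastic stability) $\mathbb{C}^T=\mathbb{C}$ and $\mathbb{C}>0$; (ii) (Fading memory) there is a positive, continuous, non-increasing, integrable weighting function $w:[0,+\infty)\to\mathbb{R}$ with $w(0)=1$ satisfying the semigroup condition $w(s)\ge w(s-t)\,w(t)$ (for $0\le t\le s$), and a constant $\gamma<1$ such that $$\int_0^{+\infty}\|\mathbb{K}(\tau)\|\,w^{-1}(\tau)\,d\tau\le\gamma,$$ where $\|\cdot\|$ is the operator norm; (iii) (Stress regularity) $\sigma\in\mathcal{N}$. Then the variational problem: find $\epsilon\in\mathcal{M}$ with $$a(\epsilon,\eta)=\int_{-\infty}^T\sigma(t)\cdot\eta(t)\,d\mu(t)\quad\text{for all }\eta\in\mathcal{M}$$ has a unique solution $\epsilon\in\mathcal{M}$, and $\|\epsilon\|_{\mathcal{M}}\le\frac{1}{1-\gamma}\|\sigma\|_{\mathcal{N}}$.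
   Context: Standing assumptions on the kernel: $\mathbb{K}(t)=0$ for $t<0$, and $\mathbb{K}(\tau)^T=\mathbb{K}(\tau)$, $\mathbb{K}(\tau)\ge 0$ for $\tau\ge0$; also $\mathbb{C}^T=\mathbb{C}$, $\mathbb{C}\ge 0$. The space $M$ of local strains is $E$ with inner product $\xi\cdot\eta\mapsto\mathbb{C}\xi\cdot\eta$; the space $N$ of local stresses is $F$ with inner product $\mathbb{C}^{-1}\sigma\cdot\tau$. The operator norm of $\mathbb{K}(\tau)$ is taken as a map from $M$ to $N$ (equivalently, of $\mathbb{C}^{-1}\mathbb{K}(\tau)$ on $M$). Given the weight $w$, define the measure $d\mu(t)=w(T-t)\,dt$ on $(-\infty,T)$. Set $\mathcal{M}=L^2((-\infty,T),M,\mu)$ with inner product $(\xi,\eta)=\int_{-\infty}^T\mathbb{C}\xi(t)\cdot\eta(t)\,d\mu(t)$, and $\mathcal{N}=L^2((-\infty,T),N,\mu)$ with norm $\|\sigma\|^2=\int_{-\infty}^T\mathbb{C}^{-1}\sigma(t)\cdot\sigma(t)\,d\mu(t)$. The plastic-strain operator is $P\epsilon(t)=\int_{-\infty}^t\mathbb{C}^{-1}\mathbb{K}(t-s)\epsilon(s)\,ds$, and the bilinear form is $a(\xi,\eta)=(\xi,\eta)-(P\xi,\eta)$ for $\xi,\eta\in\mathcal{M}$ (this is the variational form of the hereditary law $\sigma(t)=\mathbb{C}\epsilon(t)-\int_{-\infty}^t\mathbb{K}(t-s)\epsilon(s)\,ds$). *)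

(* Defs.v *)
From HB Require Import structures.
From mathcomp Require Import all_boot all_order all_algebra.
From mathcomp Require Import all_classical all_reals all_analysis.
Set Implicit Arguments. Unset Strict Implicit. Unset Printing Implicit Defensive.
Import Order.TTheory GRing.Theory Num.Theory.
Import numFieldNormedType.Exports.
Local Open Scope classical_set_scope.
Local Open Scope ring_scope.

(* Local strains / stresses: 3x3 real matrices, restricted to symmetric ones.
   Stresses (F = E^* ) are identified with symmetric matrices through the
   Frobenius pairing  sigma . eps = \sum_{i,j} sigma_ij eps_ij.             *)
Definition symm (R : realType) (A : 'M[R]_3) : Prop := A^T = A.

Definition dot (R : realType) (A B : 'M[R]_3) : R :=
  \sum_(i < 3) \sum_(j < 3) A i j * B i j.

(* A linear operator on 3x3 matrices, given by a fourth-order tensor. *)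
Definition op (R : realType) := 'I_3 -> 'I_3 -> 'I_3 -> 'I_3 -> R.

Definition app (R : realType) (A : op R) (x : 'M[R]_3) : 'M[R]_3 :=
  \matrix_(i, j) \sum_(k < 3) \sum_(l < 3) A i j k l * x k l.

Definition Cinv (R : realType) (C : op R) (s : 'M[R]_3) : 'M[R]_3 :=
  xget 0 [set x | symm x /\ app C x = s].

(* operator norm of A as a map from M (norm sqrt(C x . x)) to N
   (norm sqrt(C^{-1} s . s)) *)
Definition opnorm (R : realType) (C A : op R) : R :=
  sup [set Num.sqrt (dot (Cinv C (app A x)) (app A x)) |
        x in [set x | symm x /\ dot (app C x) x <= 1]].

Definition muint (R : realType) (T : R) (w : R -> R) (f : R -> R) : \bar R :=
  (\int[lebesgue_measure]_(t in `]-oo, T[) (f t * w (T - t))%:E)%E.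

Definition Rmuint (R : realType) (T : R) (w : R -> R) (f : R -> R) : R :=
  fine (muint T w f).

Definition inM (R : realType) (T : R) (w : R -> R) (C : op R) (x : R -> 'M[R]_3) : Prop :=
  [/\ forall t, t < T -> symm (x t),
      forall i j, measurable_fun `]-oo, T[ (fun t => x t i j) &
      (muint T w (fun t => dot (app C (x t)) (x t)) < +oo)%E].

Definition inN (R : realType) (T : R) (w : R -> R) (C : op R) (s : R -> 'M[R]_3) : Prop :=
  [/\ forall t, t < T -> symm (s t),
      forall i j, measurable_fun `]-oo, T[ (fun t => s t i j) &
      (muint T w (fun t => dot (Cinv C (s t)) (s t)) < +oo)%E].

Definition Mip (R : realType) (T : R) (w : R -> R) (C : op R) (x y : R -> 'M[R]_3) : R :=
  Rmuint T w (fun t => dot (app C (x t)) (y t)).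

Definition Mnorm (R : realType) (T : R) (w : R -> R) (C : op R) (x : R -> 'M[R]_3) : R :=
  Num.sqrt (Mip T w C x x).

Definition Nnorm (R : realType) (T : R) (w : R -> R) (C : op R) (s : R -> 'M[R]_3) : R :=
  Num.sqrt (Rmuint T w (fun t => dot (Cinv C (s t)) (s t))).

Definition Pop (R : realType) (C : op R) (K : R -> op R) (e : R -> 'M[R]_3) (t : R) : 'M[R]_3 :=
  \matrix_(i, j) Rintegral lebesgue_measure `]-oo, t]
                   (fun s => Cinv C (app (K (t - s)) (e s)) i j).

Definition aform (R : realType) (T : R) (w : R -> R) (C : op R) (K : R -> op R)
  (x y : R -> 'M[R]_3) : R :=
  Mip T w C x y - Mip T w C (Pop C K x) y.

Definition rhs (R : realType) (T : R) (w : R -> R) (s y : R -> 'M[R]_3) : R :=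
  Rmuint T w (fun t => dot (s t) (y t)).

(* Main.v *)
Require Import Defs.
From HB Require Import structures.
From mathcomp Require Import all_boot all_order all_algebra.
From mathcomp Require Import all_classical all_reals all_analysis.
From mathcomp Require Import measurable_realfun ring lra.
Import Order.TTheory GRing.Theory Num.Theory.
Import numFieldNormedType.Exports.
Local Open Scope classical_set_scope.
Local Open Scope ring_scope.
Set Implicit Arguments. Unset Strict Implicit. Unset Printing Implicit Defensive.

(* In a C-orthonormal basis of the symmetric matrices the variational problem
   becomes the Volterra equation e = h + k * e in R^n, with h the coordinates of
   the stress. Its majorant G = sum_m k^{*m} * |h|, with k the operator norm of the
   kernel, solves G = |h| + k * G in [0, +oo]. Jensen's inequality for the
   sub-probability (1 - gamma) delta + k gives
   (|h| + k * f)^2 <= |h|^2 / (1 - gamma) + k * f^2, and Tonelli's theorem with the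
   semigroup condition on w bounds the weighted integral of k * f^2 by gamma times
   that of f^2; iterating, the norm of G is at most |h| / (1 - gamma). Wherever G is
   finite, hence almost everywhere, Picard iteration is dominated by G and converges
   to a solution bounded by G. Testing the variational equation against its own
   residual shows that weak solutions satisfy the Volterra equation almost
   everywhere, and the difference d of two solutions satisfies |d| <= k * |d|, whose
   weighted norm then contracts by the factor gamma < 1. *)

(** * Euclidean coordinates for a positive tensor *)

(** Strains here are genuine functions on the line, not classes, so a solution has to be produced
    point by point. The extended-real majorant makes this possible: since k * G <= G, finiteness of
    G at one time already makes every integral of the iteration converge at that time, and no
    exceptional sets accumulate along the iteration. The constant is obtained by letting the atom of
    mass 1 - gamma carry the value |h| / (1 - gamma). The squared norms of the partial sums then
    obey W' <= I / (1 - gamma) + gamma W, with I the squared norm of the stress, and the fixed point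
    I / (1 - gamma)^2 of this recursion is the square of the claimed bound. Two masses of the kernel
    occur: Jensen's inequality needs the plain integral of k, Tonelli's theorem that of k / w.
    Hypothesis (ii) bounds the second, and w <= 1 passes the bound on to the first. The operator
    norm is a supremum over uncountably many strains, so its measurability in time, on which
    Tonelli's theorem rests, has to be reduced to countably many test vectors. *)

Section euclidean.
Context {R : realType} {n : nat}.
Implicit Types u v : 'I_n -> R.

Definition enorm v : R := Num.sqrt (\sum_p v p ^+ 2).

Lemma enorm_ge0 v : 0 <= enorm v.
Proof. exact: sqrtr_ge0. Qed.

Lemma sqr_enorm v : enorm v ^+ 2 = \sum_p v p ^+ 2.
Proof. by rewrite sqr_sqrtr// sumr_ge0// => p _; exact: sqr_ge0. Qed.

Lemma normr_le_enorm v p : `|v p| <= enorm v.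
Proof.
rewrite -sqrtr_sqr ler_wsqrtr// (bigD1 p)//= lerDl sumr_ge0// => q _.
exact: sqr_ge0.
Qed.

Lemma enorm_cst0 : enorm (fun=> 0) = 0.
Proof. by rewrite /enorm big1 ?sqrtr0// => p _; rewrite expr0n. Qed.

Lemma enorm_eq0 v : enorm v = 0 -> v = fun=> 0.
Proof.
move=> v0; apply/funext => p; apply/eqP.
by rewrite -normr_le0 -v0 normr_le_enorm.
Qed.

Lemma enormN v : enorm (fun p => - v p) = enorm v.
Proof. by rewrite /enorm; congr Num.sqrt; apply: eq_bigr => p _; rewrite sqrrN. Qed.

(** The squares of |v| u_p - |u| v_p add up to 2 |u||v| (|u||v| - u . v), and the positive factor 2
    |u||v| can be divided out. *)
Lemma cauchy_schwarz u v : \sum_p u p * v p <= enorm u * enorm v.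
Proof.
have [/enorm_eq0->|u0] := eqVneq (enorm u) 0.
  rewrite big1 ?mulr_ge0 ?enorm_ge0// => p _; exact: mul0r.
have [/enorm_eq0->|v0] := eqVneq (enorm v) 0.
  rewrite big1 ?mulr_ge0 ?enorm_ge0// => p _; exact: mulr0.
have uv0 : 0 < enorm u * enorm v.
  by rewrite mulr_gt0 ?lt_neqAle 1?eq_sym ?u0 ?v0 ?enorm_ge0.
have : 0 <= \sum_p (enorm v * u p - enorm u * v p) ^+ 2.
  by apply: sumr_ge0 => p _; exact: sqr_ge0.
have -> : \sum_p (enorm v * u p - enorm u * v p) ^+ 2 =
   enorm v ^+ 2 * (\sum_p u p ^+ 2) - 2 * (enorm u * enorm v) * (\sum_p u p * v p)
   + enorm u ^+ 2 * (\sum_p v p ^+ 2).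
  rewrite !mulr_sumr -sumrB -big_split/=; apply: eq_bigr => p _; ring.
rewrite -!sqr_enorm.
rewrite (_ : _ + _ = 2 * (enorm u * enorm v) *
    (enorm u * enorm v - \sum_p u p * v p)); last by ring.
have uv2 : 0 < 2 * (enorm u * enorm v) by rewrite mulr_gt0.
by rewrite (pmulr_rge0 _ uv2) subr_ge0.
Qed.

Lemma enormD u v : enorm (fun p => u p + v p) <= enorm u + enorm v.
Proof.
rewrite -(@ler_pXn2r _ 2)// ?nnegrE ?addr_ge0 ?enorm_ge0// sqr_enorm sqrrD.
rewrite (_ : \sum_p _ = \sum_p u p ^+ 2 + (\sum_p u p * v p) *+ 2 + \sum_p v p ^+ 2).
  by rewrite -!sqr_enorm lerD2r lerD2l lerMn2r/= cauchy_schwarz.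
by rewrite -sumrMnl -!big_split/=; apply: eq_bigr => p _; rewrite sqrrD.
Qed.

Lemma enormZ (c : R) v : enorm (fun p => c * v p) = `|c| * enorm v.
Proof.
rewrite /enorm -sqrtr_sqr -sqrtrM ?sqr_ge0// mulr_sumr.
by congr Num.sqrt; apply: eq_bigr => p _; rewrite exprMn.
Qed.

End euclidean.

Section tensors.
Context {R : realType}.
Implicit Types x y : 'M[R]_3.

Lemma dotC x y : dot x y = dot y x.
Proof. by apply: eq_bigr => i _; apply: eq_bigr => j _; rewrite mulrC. Qed.

Lemma dotDl x y z : dot (x + y) z = dot x z + dot y z.
Proof.
rewrite -big_split/=; apply: eq_bigr => i _; rewrite -big_split/=.
by apply: eq_bigr => j _; rewrite mxE mulrDl.
Qed.

Lemma dotZl c x y : dot (c *: x) y = c * dot x y.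
Proof.
rewrite mulr_sumr; apply: eq_bigr => i _; rewrite mulr_sumr.
by apply: eq_bigr => j _; rewrite mxE mulrA.
Qed.

Lemma dot0l x : dot 0 x = 0.
Proof. by rewrite -(scale0r 0) dotZl mul0r. Qed.

Lemma dotBl x y z : dot (x - y) z = dot x z - dot y z.
Proof. by rewrite dotDl -scaleN1r dotZl mulN1r. Qed.

Lemma dot_suml n (f : 'I_n -> 'M[R]_3) y :
  dot (\sum_p f p) y = \sum_p dot (f p) y.
Proof.
apply: (big_morph (fun z => dot z y)) => [u v|]; [exact: dotDl|exact: dot0l].
Qed.

Lemma dot_sumr n (f : 'I_n -> 'M[R]_3) y :
  dot y (\sum_p f p) = \sum_p dot y (f p).
Proof. by rewrite dotC dot_suml; apply: eq_bigr => p _; exact: dotC. Qed.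

Lemma dotZr c x y : dot y (c *: x) = c * dot y x.
Proof. by rewrite dotC dotZl dotC. Qed.

Lemma dot_eq0 x : dot x x = 0 -> x = 0.
Proof.
have h i : 0 <= \sum_(j < 3) x i j * x i j.
  by apply: sumr_ge0 => j _; rewrite -expr2 sqr_ge0.
move=> /eqP; rewrite psumr_eq0// => /allP x0; apply/matrixP => i j.
have := x0 i; rewrite mem_index_enum => /(_ isT) /=.
rewrite psumr_eq0 => [|k _]; last by rewrite -expr2 sqr_ge0.
move=> /allP /(_ j); rewrite mem_index_enum => /(_ isT) /=.
by rewrite mulf_eq0 orbb mxE => /eqP.
Qed.

Lemma appD (A : op R) x y : app A (x + y) = app A x + app A y.
Proof.
apply/matrixP => i j; rewrite !mxE -big_split/=; apply: eq_bigr => k _.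
by rewrite -big_split/=; apply: eq_bigr => l _; rewrite mxE mulrDr.
Qed.

Lemma appZ (A : op R) c x : app A (c *: x) = c *: app A x.
Proof.
apply/matrixP => i j; rewrite !mxE mulr_sumr; apply: eq_bigr => k _.
by rewrite mulr_sumr; apply: eq_bigr => l _; rewrite mxE mulrCA.
Qed.

Lemma app0 (A : op R) : app A 0 = 0.
Proof. by rewrite -[in LHS](scale0r 0) appZ scale0r. Qed.

Lemma app_sum (A : op R) n (f : 'I_n -> 'M[R]_3) :
  app A (\sum_p f p) = \sum_p app A (f p).
Proof. exact: (big_morph (app A) (appD A) (app0 A)). Qed.

Lemma symmD x y : symm x -> symm y -> symm (x + y).
Proof. by rewrite /symm => xs ys; rewrite linearD/= xs ys. Qed.

Lemma symmZ c x : symm x -> symm (c *: x).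
Proof. by rewrite /symm => xs; rewrite linearZ/= xs. Qed.

Lemma symm0 : symm (0 : 'M[R]_3).
Proof. exact: trmx0. Qed.

Lemma symmB x y : symm x -> symm y -> symm (x - y).
Proof. by move=> xs ys; rewrite -scaleN1r; apply/symmD/symmZ. Qed.

Lemma symm_sum n (f : 'I_n -> 'M[R]_3) :
  (forall p, symm (f p)) -> symm (\sum_p f p).
Proof.
by move=> fs; apply: big_ind => //; [exact: symm0|exact: symmD].
Qed.

End tensors.

(** * Bases of the symmetric matrices that are orthonormal for the elastic tensor *)

Section orthonormal_basis.
Context {R : realType}.
Variable C : op R.
Hypothesis Csymm : forall x : 'M[R]_3, symm x -> symm (app C x).
Hypothesis Csa : forall x y : 'M[R]_3, symm x -> symm y ->
  dot (app C x) y = dot x (app C y).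
Hypothesis Cpos : forall x : 'M[R]_3, symm x -> x != 0 -> 0 < dot (app C x) x.

Definition orthonormal_for n (b : 'I_n -> 'M[R]_3) :=
  (forall p, symm (b p)) /\
  forall p q, dot (app C (b p)) (b q) = (p == q)%:R.

(** Flattened to rows of length 9, the matrices C b_p and b_q form [B] and [D] with B D^T equal to
    the identity of size n, which forces n to be at most 9. *)
Lemma orthonormal_for_le n (b : 'I_n -> 'M[R]_3) :
  orthonormal_for b -> (n <= 3 * 3)%N.
Proof.
move=> [bs bo].
pose B := \matrix_(p < n) mxvec (app C (b p)).
pose D := \matrix_(p < n) mxvec (b p).
apply: (@mulmx1_min R _ _ B D^T); apply/matrixP => p q; rewrite !mxE -bo.
rewrite /dot pair_big/= (reindex _ (curry_mxvec_bij 3 3))/=.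
by apply: eq_bigr => -[i j] _; rewrite !mxE !mxvecE !mxE.
Qed.

(** An orthonormal family of maximal size exists because sizes are bounded. If some symmetric x
    differed from its expansion, the normalised difference [y] could be put in front of the family,
    against maximality. *)
Lemma exists_orthonormal_basis : exists n (b : 'I_n -> 'M[R]_3),
  orthonormal_for b /\
  forall x, symm x -> x = \sum_p dot (app C x) (b p) *: b p.
Proof.
pose Q n := `[< exists b : 'I_n -> 'M[R]_3, orthonormal_for b >].
have Q0 : exists n, Q n.
  by exists 0%N; apply/asboolP; exists (fun=> 0); split=> -[].
have Qle n : Q n -> (n <= 3 * 3)%N.
  by move=> /asboolP[b]; exact: orthonormal_for_le.
case: (ex_maxnP Q0 Qle) => n /asboolP[b [bs bo]] nmax.
exists n, b; split; first by split.
move=> x xs; apply/eqP; rewrite -subr_eq0; apply: contrapT => /negP y0.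
set y := x - _ in y0.
have ys : symm y by apply: symmB => //; apply: symm_sum => p; exact: symmZ.
have yb q : dot (app C y) (b q) = 0.
  rewrite /y -scaleN1r appD appZ scaleN1r dotBl app_sum dot_suml (bigD1 q)//=.
  rewrite appZ dotZl bo eqxx mulr1 big1 ?addr0 ?subrr// => p pq.
  by rewrite appZ dotZl bo (negbTE pq) mulr0.
have by0 q : dot (app C (b q)) y = 0 by rewrite Csa// dotC.
pose c := (Num.sqrt (dot (app C y) y))^-1.
pose b' (p : 'I_n.+1) := if unlift ord0 p is Some q then b q else c *: y.
have : Q n.+1.
  apply/asboolP; exists b'; split.
    by move=> p; rewrite /b'; case: unliftP => // *; exact: symmZ.
  move=> p q; rewrite /b'.
  case: unliftP => [p' ->|->]; case: unliftP => [q' ->|->].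
  - by rewrite bo (inj_eq lift_inj).
  - by rewrite dotZr by0 mulr0 eq_sym (negbTE (neq_lift _ _)).
  - by rewrite appZ dotZl yb mulr0 (negbTE (neq_lift _ _)).
  - have yy := Cpos ys y0.
    rewrite appZ dotZl dotZr mulrA eqxx /c -invfM -expr2 sqr_sqrtr ?ltW//.
    by rewrite mulVf// gt_eqF.
by move=> /nmax; rewrite ltnn.
Qed.

Context {n : nat}.
Variable b : 'I_n -> 'M[R]_3.
Hypothesis bON : orthonormal_for b.
Hypothesis bspan : forall x, symm x -> x = \sum_p dot (app C x) (b p) *: b p.

Let bs p : symm (b p). Proof. by case: bON. Qed.

Lemma coord_sum (v : 'I_n -> R) q :
  dot (app C (\sum_p v p *: b p)) (b q) = v q.
Proof.
rewrite app_sum dot_suml (bigD1 q)//= appZ dotZl bON.2 eqxx mulr1 big1 ?addr0//.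
by move=> p pq; rewrite appZ dotZl bON.2 (negbTE pq) mulr0.
Qed.

Lemma dot_coord s y : symm y ->
  dot s y = \sum_p dot s (b p) * dot (app C y) (b p).
Proof.
move=> ys; rewrite {1}(bspan ys) dot_sumr; apply: eq_bigr => p _.
by rewrite dotZr mulrC.
Qed.

Lemma dot_coord0 s : symm s -> (forall p, dot s (b p) = 0) -> s = 0.
Proof.
move=> ss s0; apply: dot_eq0; rewrite dot_coord//.
by rewrite big1// => p _; rewrite s0 mul0r.
Qed.

(** The coordinates of x in the basis are C x . b_p, so C x = s forces them to be s . b_p. The
    candidate is thus the only symmetric solution, and the default value in [Cinv] never occurs for
    a symmetric [s]. *)
Lemma CinvE s : symm s -> Cinv C s = \sum_p dot s (b p) *: b p.
Proof.
move=> ss; rewrite /Cinv; set x0 := \sum_p _.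
have x0s : symm x0 by apply: symm_sum => p; exact: symmZ.
apply: xget_unique.
  split=> //; apply/eqP; rewrite -subr_eq0; apply/eqP; apply: dot_coord0.
    by apply: symmB => //; exact: Csymm.
  by move=> p; rewrite dotBl coord_sum subrr.
move=> y [ys yE]; rewrite (bspan ys) /x0; apply: eq_bigr => p _.
by rewrite yE.
Qed.

Lemma dot_Cinv s : symm s -> dot (Cinv C s) s = enorm (fun p => dot s (b p)) ^+ 2.
Proof.
move=> ss; rewrite sqr_enorm CinvE// dot_suml; apply: eq_bigr => p _.
by rewrite dotZl (dotC (b p)) expr2.
Qed.

Lemma dot_app x : symm x ->
  dot (app C x) x = enorm (fun p => dot (app C x) (b p)) ^+ 2.
Proof.
by move=> xs; rewrite sqr_enorm dot_coord//; under eq_bigr do rewrite -expr2.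
Qed.

(** Matrix of C^{-1} A in the basis [b]: column q holds the stress coordinates of A b_q. *)
Definition mxtensor (A : op R) (p q : 'I_n) : R := dot (app A (b q)) (b p).

Lemma app_coord (A : op R) x p : symm x ->
  dot (app A x) (b p) = \sum_q mxtensor A p q * dot (app C x) (b q).
Proof.
move=> xs; rewrite {1}(bspan xs) app_sum dot_suml; apply: eq_bigr => q _.
by rewrite appZ dotZl mulrC.
Qed.

Lemma symm_coord_inj x y : symm x -> symm y ->
  (forall p, dot (app C x) (b p) = dot (app C y) (b p)) -> x = y.
Proof.
move=> xs ys xy; rewrite (bspan xs) (bspan ys).
by apply: eq_bigr => p _; rewrite xy.
Qed.

End orthonormal_basis.

(** * Measurability of the operator norm *)

Section operator_norm.
Context {R : realType} {n : nat}.
Implicit Types (A : 'I_n -> 'I_n -> R) (u v : 'I_n -> R).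

Definition mulv A v (p : 'I_n) : R := \sum_q A p q * v q.

Definition eopnorm A : R := sup [set enorm (mulv A v) | v in [set v | enorm v <= 1]].

Lemma enorm_le u v : (forall p, `|u p| <= `|v p|) -> enorm u <= enorm v.
Proof.
move=> uv; apply: ler_wsqrtr; apply: ler_sum => p _.
by rewrite -(real_normK (num_real (u p))) -(real_normK (num_real (v p)))
  lerXn2r ?nnegrE// uv.
Qed.

Lemma mulvD A u v : mulv A (fun q => u q + v q) = fun p => mulv A u p + mulv A v p.
Proof.
by apply/funext => p; rewrite -big_split/=; apply: eq_bigr => q _; rewrite mulrDr.
Qed.

Lemma mulvZ A (c : R) v : mulv A (fun q => c * v q) = fun p => c * mulv A v p.
Proof.
by apply/funext => p; rewrite mulr_sumr; apply: eq_bigr => q _; rewrite mulrCA.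
Qed.

Lemma mulv0 A : mulv A (fun=> 0) = fun=> 0.
Proof. by apply/funext => p; rewrite /mulv big1// => q _; rewrite mulr0. Qed.

Lemma eopnorm_has_sup A :
  has_sup [set enorm (mulv A v) | v in [set v | enorm v <= 1]].
Proof.
split.
  by exists (enorm (mulv A (fun=> 0))); exists (fun=> 0) => //=; rewrite enorm_cst0.
exists (enorm (fun p => \sum_q `|A p q|)) => _ [v /= v1 <-].
apply: enorm_le => p; rewrite [leRHS]ger0_norm; last exact: sumr_ge0.
apply: (le_trans (ler_norm_sum _ _ _)); apply: ler_sum => q _.
by rewrite normrM ler_piMr// (le_trans (normr_le_enorm _ _)).
Qed.

Lemma eopnorm_ge0 A : 0 <= eopnorm A.
Proof.
apply: (le_trans (enorm_ge0 (mulv A (fun=> 0)))).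
apply: (ub_le_sup (eopnorm_has_sup A).2).
by exists (fun=> 0) => //=; rewrite enorm_cst0.
Qed.

Lemma enorm_mulv A v : enorm (mulv A v) <= eopnorm A * enorm v.
Proof.
have [/enorm_eq0 ->|v0] := eqVneq (enorm v) 0.
  by rewrite mulv0 !enorm_cst0 mulr0.
have v_gt0 : 0 < enorm v by rewrite lt_neqAle eq_sym v0 enorm_ge0.
rewrite -ler_pdivrMr// mulrC -[X in X * _]gtr0_norm ?invr_gt0// -enormZ -mulvZ.
apply: (ub_le_sup (eopnorm_has_sup A).2).
exists (fun q => (enorm v)^-1 * v q) => //=.
by rewrite enormZ gtr0_norm ?invr_gt0// mulVf.
Qed.

(* Rounding [m v] to an integer vector moves it by a bounded amount, so for large
   [m] the strict inequality survives. *)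
Lemma eopnorm_gtP A (a : R) : 0 <= a ->
  a < eopnorm A <-> exists z : {ffun 'I_n -> int},
    a * enorm (fun q => (z q)%:~R : R) < enorm (mulv A (fun q => (z q)%:~R)).
Proof.
move=> a0; split; last first.
  move=> [z /lt_le_trans/(_ (enorm_mulv _ _))].
  rewrite ltNge => h; rewrite ltNge; apply: contra h => h.
  by rewrite ler_wpM2r ?enorm_ge0.
move=> /(sup_gt (eopnorm_has_sup A).1)[_ [v /= v1 <-] aAv].
pose d := enorm (mulv A v) - a.
have d0 : 0 < d by rewrite subr_gt0.
pose c : R := enorm (fun _ : 'I_n => 1).
(* Rounding m v costs at most |A| c on the side of |A z| and a c on the side of a |z|, where c is
   the norm of the all-ones vector; the gained margin m d has to exceed both together. *)
pose m := Num.bound ((eopnorm A + a) * c / d).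
have mgt : (eopnorm A + a) * c < m%:R * d.
  rewrite -ltr_pdivrMr//; apply: archi_boundP.
  by rewrite divr_ge0 ?(ltW d0)// mulr_ge0 ?enorm_ge0// addr_ge0 ?eopnorm_ge0.
exists [ffun q => Num.floor (m%:R * v q)].
set z : 'I_n -> R := fun q => _.
pose e : 'I_n -> R := fun q => z q - m%:R * v q.
have ec : enorm e <= c.
  apply: enorm_le => q; rewrite normr1 /e /z ffunE.
  have /andP[] := floor_itv (m%:R * v q); rewrite intrD => h1 h2.
  by rewrite ler0_norm ?subr_le0//; lra.
have mAv : m%:R * enorm (mulv A v) <= enorm (mulv A z) + eopnorm A * c.
  rewrite -[X in X * _]ger0_norm// -enormZ -mulvZ.
  rewrite (_ : (fun q => _) = fun q => z q + (- 1) * e q); last first.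
    by apply/funext => q; rewrite /e; ring.
  rewrite mulvD mulvZ; apply: (le_trans (enormD _ _)); rewrite lerD2l.
  rewrite enormZ normrN1 mul1r (le_trans (enorm_mulv _ _))//.
  by rewrite ler_wpM2l// eopnorm_ge0.
have az : a * enorm z <= a * m%:R + a * c.
  rewrite -mulrDr ler_wpM2l//.
  rewrite (_ : z = fun q => m%:R * v q + e q); last first.
    by apply/funext => q; rewrite /e; ring.
  rewrite (le_trans (enormD _ _))// lerD// enormZ ger0_norm//.
  by rewrite ler_piMr.
apply: (le_lt_trans az); move: mgt; rewrite /d; nra.
Qed.

Lemma measurable_enorm d (U : measurableType d) (D : set U) (f : 'I_n -> U -> R) :
  (forall p, measurable_fun D (f p)) -> measurable_fun D (fun t => enorm (f ^~ t)).
Proof.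
move=> mf; apply: (@measurableT_comp _ _ _ _ _ _ (@Num.sqrt R) _
  (fun t => \sum_p f p t ^+ 2)).
  by apply: continuous_measurable_fun; exact: sqrt_continuous.
by apply: measurable_sum => p; exact: measurable_funX.
Qed.

Lemma measurable_mulv d (U : measurableType d) (D : set U)
    (A : U -> 'I_n -> 'I_n -> R) (f : 'I_n -> U -> R) p :
  (forall p q, measurable_fun D (fun t => A t p q)) ->
  (forall p, measurable_fun D (f p)) ->
  measurable_fun D (fun t => mulv (A t) (f ^~ t) p).
Proof.
by move=> mA mf; apply: measurable_sum => q; exact: measurable_funM.
Qed.

(** For a >= 0 the set where the norm exceeds a is a countable union, over integer vectors, of sets
    that are measurable because the entries are. *)
Lemma measurable_eopnorm d (U : measurableType d) (A : U -> 'I_n -> 'I_n -> R) :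
  (forall p q, measurable_fun setT (fun t => A t p q)) ->
  measurable_fun setT (fun t => eopnorm (A t)).
Proof.
move=> mA; apply: (measurability _ (RGenOInfty.measurableE R)) => //.
move=> /= _ [_ [a ->] <-]; rewrite setTI.
have [a0|a0] := leP 0 a; last first.
  rewrite (_ : _ @^-1` _ = setT); first exact: measurableT.
  apply/seteqP; split=> // t _ /=.
  by rewrite in_itv/= andbT (lt_le_trans a0)// eopnorm_ge0.
rewrite (_ : _ @^-1` _ = \bigcup_(z in [set: {ffun 'I_n -> int}])
    [set t | a * enorm (fun q => (z q)%:~R : R) <
             enorm (mulv (A t) (fun q => (z q)%:~R))]).
  apply: countable_bigcupT_measurable => // z.
  rewrite -[X in measurable X]setTI.
  apply: measurable_fun_ltr => //.
  apply: measurable_enorm => p.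
  exact: (@measurable_mulv _ _ _ A (fun q _ => (z q)%:~R)).
apply/seteqP; split=> t /=; rewrite in_itv/= andbT.
  by move=> /(eopnorm_gtP _ a0)[z za]; exists z.
by move=> [z _ za]; apply/(eopnorm_gtP _ a0); exists z.
Qed.

End operator_norm.

Section opnorm_coordinates.
Context {R : realType} {n : nat}.
Variables (C : op R) (b : 'I_n -> 'M[R]_3).
Hypothesis Csymm : forall x : 'M[R]_3, symm x -> symm (app C x).
Hypothesis bON : orthonormal_for C b.
Hypothesis bspan : forall x, symm x -> x = \sum_p dot (app C x) (b p) *: b p.

(** The coordinates C x . b_p make M isometric to R^n and the coordinates s . b_p do the same for N,
    so both suprema are taken over the same set of numbers. *)
Lemma opnormE (A : op R) : (forall x : 'M[R]_3, symm x -> symm (app A x)) ->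
  opnorm C A = eopnorm (mxtensor b A).
Proof.
move=> As; congr sup.
have E x : symm x -> Num.sqrt (dot (Cinv C (app A x)) (app A x)) =
    enorm (mulv (mxtensor b A) (fun p => dot (app C x) (b p))).
  move=> xs; rewrite (dot_Cinv Csymm bON bspan (As _ xs)).
  rewrite sqrtr_sqr ger0_norm ?enorm_ge0//.
  by congr enorm; apply/funext => p; rewrite (app_coord bspan).
apply/seteqP; split.
  move=> _ [x /= [xs x1] <-]; exists (fun p => dot (app C x) (b p)); last by rewrite E.
  rewrite /= -(@ler_pXn2r _ 2) ?nnegrE ?enorm_ge0//.
  by rewrite -(dot_app bspan)// expr1n.
move=> _ [v /= v1 <-]; exists (\sum_p v p *: b p) => /=; last first.
  rewrite E; last by apply: symm_sum => p; apply: symmZ; case: bON.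
  by congr (enorm (mulv _ _)); apply/funext => p; rewrite (coord_sum bON).
have xs : symm (\sum_p v p *: b p).
  by apply: symm_sum => p; apply: symmZ; case: bON.
split=> //; rewrite (dot_app bspan)//.
rewrite (_ : (fun p => _) = v); last by apply/funext => p; rewrite (coord_sum bON).
by rewrite expr_le1 ?enorm_ge0.
Qed.

End opnorm_coordinates.

(** * Convolution with a fading kernel *)

Section translation.
Context {R : realType}.
Local Notation mu := (@lebesgue_measure R).
Local Open Scope ereal_scope.

Lemma lebesgue_measure_translation (a : R) (A : set R) : measurable A ->
  pushforward mu ((fun x => x - a)%R : _ -> measurableTypeR R) A = mu A.
Proof.
move=> mA.
have mphi : measurable_fun [set: measurableTypeR R]
    ((fun x => x - a)%R : measurableTypeR R -> measurableTypeR R).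
  exact: measurable_funB.
apply/esym/lebesgue_measure_unique => //= _ [[x y]] _ <-.
rewrite /pushforward (_ : _ @^-1` _ = `](x + a)%R, (y + a)%R]%classic).
  rewrite !lebesgue_measure_itv/= !lte_fin ltrD2r; case: ifPn => // _.
  by rewrite -!EFinD; congr EFin; ring.
by apply/seteqP; split=> t /=; rewrite !in_itv/= ltrBrDr lerBlDr.
Qed.

Lemma ge0_integral_translation (a : R) (f : R -> \bar R) :
  measurable_fun setT f -> (forall x, 0 <= f x) ->
  \int[mu]_x f (x - a)%R = \int[mu]_x f x.
Proof.
move=> mf f0.
have mphi : measurable_fun [set: measurableTypeR R]
    ((fun x => x - a)%R : measurableTypeR R -> measurableTypeR R).
  exact: measurable_funB.
rewrite -[LHS](ge0_integral_pushforward mphi mu measurableT mf)//.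
by apply: eq_measure_integral => A mA _; exact: lebesgue_measure_translation.
Qed.

Lemma ge0_integral_reflection (a : R) (f : R -> \bar R) :
  measurable_fun setT f -> (forall x, 0 <= f x) ->
  \int[mu]_x f (a - x)%R = \int[mu]_x f x.
Proof.
move=> mf f0; rewrite -(ge0_integral_translation (- a) mf f0).
have mg : measurable_fun setT (fun x : R => f (x - - a)%R).
  by apply: (measurableT_comp mf); apply: measurable_funB.
have mphi : measurable_fun [set: measurableTypeR R]
    (-%R : measurableTypeR R -> measurableTypeR R) by [].
transitivity (\int[pushforward mu (-%R : measurableTypeR R -> measurableTypeR R)]_x
    f (x - - a)%R).
  rewrite (ge0_integral_pushforward mphi mu measurableT mg)//.
  by apply: eq_integral => x _ /=; rewrite opprK addrC.
by apply: eq_measure_integral => A mA _; exact: lebesgue_measureN.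
Qed.
End translation.

Section convolution.
Context {R : realType}.
Local Notation mu := (@lebesgue_measure R).
Local Open Scope ereal_scope.

(** The integral runs over the whole line; causality is left to the vanishing of [k] at negative
    times. Values in [0, +oo] avoid any convergence condition for nonnegative data. *)
Definition conv (k : R -> R) (f : R -> \bar R) (t : R) : \bar R :=
  \int[mu]_s ((k (t - s))%:E * f s).

Lemma measurable_sub : measurable_fun setT (fun z : R * R => (z.1 - z.2)%R).
Proof. by apply: measurable_funB; [exact: measurable_fst|exact: measurable_snd]. Qed.

Lemma measurable_fun_conv_kernel (k : R -> R) (f : R -> \bar R) :
  measurable_fun setT k -> measurable_fun setT f ->
  measurable_fun setT (fun z : R * R => (k (z.1 - z.2))%:E * f z.2).
Proof.
move=> mk mf; apply: emeasurable_funM.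
  apply/measurable_EFinP; exact: (measurableT_comp mk measurable_sub).
exact: (measurableT_comp mf (@measurable_snd _ _ _ _)).
Qed.

Lemma measurable_conv_section (k : R -> R) (f : R -> \bar R) (t : R) :
  measurable_fun setT k -> measurable_fun setT f ->
  measurable_fun setT (fun s : R => (k (t - s))%:E * f s).
Proof.
move=> mk mf; apply: emeasurable_funM => //; apply/measurable_EFinP.
by apply: (measurableT_comp mk); apply: measurable_funB.
Qed.

Lemma measurable_conv (k : R -> R) (f : R -> \bar R) :
  (forall t, (0 <= k t)%R) -> (forall t, 0 <= f t) ->
  measurable_fun setT k -> measurable_fun setT f -> measurable_fun setT (conv k f).
Proof.
move=> k0 f0 mk mf.
apply: (@measurable_fun_fubini_tonelli_F _ _ _ _ _ mu
  (fun z : R * R => (k (z.1 - z.2))%:E * f z.2)).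
- exact: measurable_fun_conv_kernel.
- by move=> z; rewrite mule_ge0// lee_fin.
Qed.

Lemma conv_ge0 (k : R -> R) (f : R -> \bar R) (t : R) :
  (forall t, (0 <= k t)%R) -> (forall t, 0 <= f t) ->
  0 <= conv k f t.
Proof. by move=> k0 f0; apply: integral_ge0 => s _; rewrite mule_ge0// lee_fin. Qed.

Lemma le_conv (k : R -> R) (f g : R -> \bar R) (t : R) :
  (forall t, (0 <= k t)%R) -> (forall t, 0 <= f t) ->
  measurable_fun setT k -> measurable_fun setT f -> measurable_fun setT g ->
  (forall s, f s <= g s) -> conv k f t <= conv k g t.
Proof.
move=> k0 f0 mk mf mg fg; apply: ge0_le_integral => //.
- by move=> s _; rewrite mule_ge0// lee_fin.
- exact: measurable_conv_section.
- exact: measurable_conv_section.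
- by move=> s _; rewrite lee_wpmul2l// lee_fin.
Qed.

Lemma young_ereal (l : R) (y : \bar R) : (0 <= l)%R -> 0 <= y ->
  (2 * l)%:E * y <= (l ^+ 2)%:E + y * y.
Proof.
move=> l0; case: y => [r||//] r0; last by rewrite mulyy addey// leey.
rewrite -!EFinM -EFinD lee_fin; have := sqr_ge0 (l - r); nra.
Qed.

Lemma ge0_sqr_le (x y : \bar R) : 0 <= x -> x <= y -> x * x <= y * y.
Proof. by move=> x0 xy; apply: lee_pmul. Qed.

(** Intended reading: [k] is the operator norm of the kernel, [kap] is k / w, and [om] is the
    density w(T - t) of mu, extended by 0. The field [fk_omk] is the semigroup condition w(T - t)
    w(t - s) <= w(T - s) multiplied by k(t - s) / w(t - s); it is the only link between weight and
    convolution. *)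
Record fading_kernel (k kap om : R -> R) (gam : R) : Prop := FadingKernel {
  fk_k0 : forall t, (0 <= k t)%R;
  fk_kap0 : forall t, (0 <= kap t)%R;
  fk_om0 : forall t, (0 <= om t)%R;
  fk_mk : measurable_fun setT k;
  fk_mkap : measurable_fun setT kap;
  fk_mom : measurable_fun setT om;
  fk_kkap : forall t, (k t <= kap t)%R;
  fk_intkap : \int[mu]_t (kap t)%:E <= gam%:E;
  fk_gam1 : (gam < 1)%R;
  fk_omk : forall t s, (om t * k (t - s) <= om s * kap (t - s))%R }.

Definition wint (om : R -> R) (f : R -> \bar R) : \bar R :=
  \int[mu]_t ((om t)%:E * f t).

Section weighted.
Variables (k kap om : R -> R) (gam : R).
Hypothesis kP : fading_kernel k kap om gam.
Local Notation wint := (wint om).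

Let k0 : forall t, (0 <= k t)%R := fk_k0 kP.
Let kap0 : forall t, (0 <= kap t)%R := fk_kap0 kP.
Let om0 : forall t, (0 <= om t)%R := fk_om0 kP.
Let mk : measurable_fun setT k := fk_mk kP.
Let mkap : measurable_fun setT kap := fk_mkap kP.
Let mom : measurable_fun setT om := fk_mom kP.
Let kkap : forall t, (k t <= kap t)%R := fk_kkap kP.
Let intkap : \int[mu]_t (kap t)%:E <= gam%:E := fk_intkap kP.
Let gam1 : (gam < 1)%R := fk_gam1 kP.
Let omk : forall t s, (om t * k (t - s) <= om s * kap (t - s))%R := fk_omk kP.

Lemma gam_ge0 : (0 <= gam)%R.
Proof.
rewrite -lee_fin; apply: le_trans intkap.
by apply: integral_ge0 => t _; rewrite lee_fin.
Qed.

Let gam1' : (0 < 1 - gam)%R. Proof. by rewrite subr_gt0. Qed.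

Lemma intk (t : R) : \int[mu]_s (k (t - s))%:E <= gam%:E.
Proof.
have mkE : measurable_fun setT (EFin \o k) by exact/measurable_EFinP.
rewrite (ge0_integral_reflection t mkE)//.
apply: le_trans intkap; apply: ge0_le_integral => //.
- by move=> x _; rewrite lee_fin.
- exact/measurable_EFinP.
- by move=> x _; rewrite lee_fin.
Qed.

(** Cauchy-Schwarz in linearised form: 2 l f <= l^2 + f^2 is integrated against k(t - s) ds. The
    free parameter [l] replaces square roots, which keeps the inequality meaningful for infinite
    values. *)
Lemma conv_scaled_le (f : R -> \bar R) (t l : R) : (0 <= l)%R -> (forall s, 0 <= f s) ->
  measurable_fun setT f ->
  (2 * l)%:E * conv k f t <=
    (l ^+ 2 * gam)%:E + conv k (fun s => f s * f s) t.
Proof.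
move=> l0 f0 mf.
have mks : measurable_fun setT (fun s : R => (k (t - s))%:E).
  by apply/measurable_EFinP; apply: (measurableT_comp mk); apply: measurable_funB.
have mff : measurable_fun setT (fun s => f s * f s) by exact: emeasurable_funM.
rewrite /conv -ge0_integralZl_EFin//; first last.
- by rewrite mulr_ge0.
- exact: measurable_conv_section.
- by move=> s _; rewrite mule_ge0// lee_fin.
apply: (@le_trans _ _ (\int[mu]_s ((l ^+ 2)%:E * (k (t - s))%:E +
    (k (t - s))%:E * (f s * f s)))).
  apply: ge0_le_integral => //.
  - by move=> s _; rewrite !mule_ge0// lee_fin// mulr_ge0.
  - by apply: emeasurable_funM => //; exact: measurable_conv_section.
  - apply: emeasurable_funD; last exact: measurable_conv_section.
    exact: emeasurable_funM.
  - move=> s _; rewrite muleCA [X in _ <= X + _]muleC -ge0_muleDr ?lee_fin ?sqr_ge0//.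
      by rewrite lee_wpmul2l ?lee_fin// young_ereal.
    by rewrite mule_ge0.
rewrite ge0_integralD//; first last.
- exact: measurable_conv_section.
- by move=> s _; rewrite !mule_ge0// lee_fin.
- exact: emeasurable_funM.
- by move=> s _; rewrite !mule_ge0// lee_fin// sqr_ge0.
rewrite leeD2r// ge0_integralZl_EFin//; last 2 first.
- by move=> s _; rewrite lee_fin.
- exact: sqr_ge0.
by rewrite (EFinM (l ^+ 2)) lee_wpmul2l ?lee_fin ?sqr_ge0// intk.
Qed.

(* Jensen's inequality for the sub-probability (1 - gam) delta + k(t - s) ds. *)
Lemma conv_jensen (g : R) (f : R -> \bar R) (t : R) :
  (0 <= g)%R -> (forall s, 0 <= f s) ->
  measurable_fun setT f ->
  (g%:E + conv k f t) * (g%:E + conv k f t) <=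
    (g ^+ 2 / (1 - gam))%:E + conv k (fun s => f s * f s) t.
Proof.
move=> g0 f0 mf.
have := conv_scaled_le t _ f0 mf; have := conv_ge0 t k0 f0.
have : 0 <= conv k (fun s => f s * f s) t.
  by apply: conv_ge0 => // s; exact: mule_ge0.
case: (conv k f t) => [r||//]; case: (conv k _ t) => [j||//] //=.
- move=> j0; rewrite lee_fin => r0.
  have gr0 : (0 <= g + r)%R by rewrite addr_ge0.
  (* The parameter l is the left-hand quantity g + r itself. Adding 2 (g + r) g to both sides gives
     2 (g + r)^2 on the left, and completing a square bounds the added term. *)
  move=> /(_ _ gr0); rewrite -!EFinD -!EFinM !lee_fin => h.
  suff : (2 * (g + r) * g <= (1 - gam) * (g + r) ^+ 2 + g ^+ 2 / (1 - gam))%R.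
    by move: h; nra.
  rewrite -subr_ge0 (_ : _ - _ = (1 - gam) * ((g + r) - g / (1 - gam)) ^+ 2)%R.
    by rewrite mulr_ge0 ?sqr_ge0// ltW.
  by field; rewrite gt_eqF.
- by move=> _ _ _; rewrite addey// leey.
(* When k * f^2 is finite, k * f cannot be infinite: the scaled inequality at l = 1 would bound +oo
   by a real number. *)
- by move=> _ _ /(_ 1%R ler01); rewrite mulr1 gt0_muley ?lte_fin// -EFinD leye_eq.
Qed.

Lemma measurable_wint (f : R -> \bar R) : measurable_fun setT f ->
  measurable_fun setT (fun t => (om t)%:E * f t).
Proof. by move=> mf; apply: emeasurable_funM => //; exact/measurable_EFinP. Qed.

Lemma wint_ge0 (f : R -> \bar R) : (forall t, 0 <= f t) -> 0 <= wint f.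
Proof. by move=> f0; apply: integral_ge0 => s _; rewrite mule_ge0// lee_fin. Qed.

Lemma wint_conv (f : R -> \bar R) : (forall s, 0 <= f s) -> measurable_fun setT f ->
  wint (conv k f) <= gam%:E * wint f.
Proof.
move=> f0 mf.
have mh : measurable_fun setT
    (fun z : R * R => (om z.1)%:E * ((k (z.1 - z.2))%:E * f z.2)).
  apply: emeasurable_funM; last exact: measurable_fun_conv_kernel.
  by apply/measurable_EFinP; apply: (measurableT_comp mom); exact: measurable_fst.
have h0 z : 0 <= (om z.1)%:E * ((k (z.1 - z.2))%:E * f z.2).
  by rewrite !mule_ge0// lee_fin.
rewrite [leLHS](_ : _ =
    \int[mu]_t \int[mu]_s ((om t)%:E * ((k (t - s))%:E * f s))); last first.
  apply: eq_integral => t _; rewrite ge0_integralZl_EFin//.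
  - by move=> s _; rewrite mule_ge0// lee_fin.
  - exact: measurable_conv_section.
rewrite (fubini_tonelli (m1 := mu) (m2 := mu) _ mh h0)/=.
rewrite /wint -ge0_integralZl_EFin//; first last.
- exact: gam_ge0.
- exact: measurable_wint.
- by move=> s _; rewrite mule_ge0// lee_fin.
have mkape : measurable_fun setT (EFin \o kap) by exact/measurable_EFinP.
apply: ge0_le_integral => //.
- by move=> s _; apply: integral_ge0 => t _; exact: (h0 (t, s)).
- exact: (measurable_fun_fubini_tonelli_G (m1 := mu) _ mh h0).
- by apply: emeasurable_funM => //; exact: measurable_wint.
(* The weight at t is traded for the weight at s, which is constant in the inner integral; only the
   mass of [kap] remains there. *)
move=> s _; apply: (@le_trans _ _ (\int[mu]_t (((om s)%:E * f s) * (kap (t - s))%:E))).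
  apply: ge0_le_integral => //.
  - by move=> t _; exact: (h0 (t, s)).
  - apply: emeasurable_funM; first exact/measurable_EFinP.
    apply: emeasurable_funM => //; apply/measurable_EFinP.
    by apply: (measurableT_comp mk); apply: measurable_funB.
  - apply: emeasurable_funM => //.
    by apply: (measurableT_comp mkape); apply: measurable_funB.
  - move=> t _; rewrite muleA [leRHS]muleAC lee_wpmul2r// -!EFinM lee_fin.
    exact: omk.
rewrite ge0_integralZl//; first last.
- by rewrite mule_ge0// lee_fin.
- by move=> t _; rewrite lee_fin.
- by apply: (measurableT_comp mkape); apply: measurable_funB.
rewrite muleC lee_wpmul2r//; first by rewrite mule_ge0// lee_fin.
by rewrite (ge0_integral_translation s mkape).
Qed.

Lemma wint_add_conv (g : R -> R) (f : R -> \bar R) :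
  (forall s, (0 <= g s)%R) -> measurable_fun setT g ->
  (forall s, 0 <= f s) -> measurable_fun setT f ->
  wint (fun t => ((g t)%:E + conv k f t) * ((g t)%:E + conv k f t)) <=
    (1 - gam)^-1%:E * wint (fun t => (g t ^+ 2)%:E) + gam%:E * wint (fun t => f t * f t).
Proof.
move=> g0 mg f0 mf.
have mff : measurable_fun setT (fun s => f s * f s) by exact: emeasurable_funM.
have ff0 s : 0 <= f s * f s by exact: mule_ge0.
have mg2 : measurable_fun setT (fun t => (g t ^+ 2)%:E).
  by apply/measurable_EFinP; exact: measurable_funX.
have mX : measurable_fun setT (fun t => (g t)%:E + conv k f t).
  by apply: emeasurable_funD; [exact/measurable_EFinP|exact: measurable_conv].
have X0 t : 0 <= (g t)%:E + conv k f t by rewrite adde_ge0 ?lee_fin// conv_ge0.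
apply: (@le_trans _ _ (\int[mu]_t ((1 - gam)^-1%:E * ((om t)%:E * (g t ^+ 2)%:E) +
    (om t)%:E * conv k (fun s => f s * f s) t))).
  apply: ge0_le_integral => //.
  - by move=> t _; rewrite !mule_ge0// lee_fin.
  - by apply: measurable_wint; exact: emeasurable_funM.
  - apply: emeasurable_funD.
      by apply: emeasurable_funM => //; exact: measurable_wint.
    by apply: measurable_wint; exact: measurable_conv.
  - move=> t _; rewrite [X in _ <= X + _]muleCA -ge0_muleDr.
    + rewrite lee_wpmul2l ?lee_fin//; apply: (le_trans (conv_jensen t (g0 t) f0 mf)).
      by rewrite -EFinM mulrC.
    + by rewrite -EFinM lee_fin mulr_ge0 ?sqr_ge0// invr_ge0 ltW.
    + exact: conv_ge0.
rewrite ge0_integralD//; first last.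
- by apply: measurable_wint; exact: measurable_conv.
- by move=> t _; rewrite mule_ge0 ?lee_fin// conv_ge0.
- by apply: emeasurable_funM => //; exact: measurable_wint.
- by move=> t _; rewrite !mule_ge0 ?lee_fin ?sqr_ge0// invr_ge0 ltW.
rewrite ge0_integralZl_EFin//; last 3 first.
- by move=> t _; rewrite !mule_ge0 ?lee_fin ?sqr_ge0.
- exact: measurable_wint.
- by rewrite invr_ge0 ltW.
by rewrite leeD2l// wint_conv.
Qed.

End weighted.
End convolution.

(** * The Neumann majorant *)

Section neumann.
Context {R : realType}.
Local Notation mu := (@lebesgue_measure R).
Local Open Scope ereal_scope.
Variables (k kap om : R -> R) (gam : R).
Hypothesis kP : fading_kernel k kap om gam.
Variable g : R -> R.
Hypothesis g0 : forall t, (0 <= g t)%R.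
Hypothesis mg : measurable_fun setT g.

Let k0 : forall t, (0 <= k t)%R := fk_k0 kP.
Let mk : measurable_fun setT k := fk_mk kP.

Definition neumann (m : nat) : R -> \bar R := iter m (conv k) (EFin \o g).
Definition neumann_sum (m : nat) (t : R) : \bar R := \sum_(0 <= i < m) neumann i t.
Definition majorant (t : R) : \bar R := \sum_(0 <= i <oo) neumann i t.

Lemma neumann_ge0 m t : 0 <= neumann m t.
Proof.
elim: m t => [|m IH] t; first by rewrite lee_fin.
by rewrite /neumann iterS; exact: conv_ge0.
Qed.

Lemma measurable_neumann m : measurable_fun setT (neumann m).
Proof.
elim: m => [|m IH]; first exact/measurable_EFinP.
rewrite /neumann iterS; apply: measurable_conv => //; exact: neumann_ge0.
Qed.

Lemma neumann_sum_ge0 m t : 0 <= neumann_sum m t.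
Proof. by apply: sume_ge0 => i _; exact: neumann_ge0. Qed.

Lemma measurable_neumann_sum m : measurable_fun setT (neumann_sum m).
Proof. by apply: emeasurable_sum => i; exact: measurable_neumann. Qed.

Lemma neumann_sum_le m t : neumann_sum m t <= majorant t.
Proof. by apply: nneseries_lim_ge => i _ _; exact: neumann_ge0. Qed.

Lemma nd_neumann_sum t : nondecreasing_seq (neumann_sum ^~ t).
Proof. by apply: ereal_nondecreasing_series => i _ _; exact: neumann_ge0. Qed.

Lemma neumann_sum_cvg t : neumann_sum ^~ t @ \oo --> majorant t.
Proof. by apply: is_cvg_nneseries => i _ _; exact: neumann_ge0. Qed.

Lemma majorant_ge0 t : 0 <= majorant t.
Proof. by apply: nneseries_ge0 => i _ _; exact: neumann_ge0. Qed.

Lemma measurable_majorant : measurable_fun setT majorant.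
Proof.
apply: (emeasurable_fun_cvg neumann_sum) => [m|t _].
  exact: measurable_neumann_sum.
exact: neumann_sum_cvg.
Qed.

Lemma neumann_sumS m t :
  neumann_sum m.+1 t = (g t)%:E + conv k (neumann_sum m) t.
Proof.
rewrite /neumann_sum big_nat_recl//; congr (_ + _).
transitivity (\int[mu]_s (\sum_(0 <= i < m) ((k (t - s))%:E * neumann i s))); last first.
  by apply: eq_integral => s _; rewrite ge0_sume_distrr// => i _; exact: neumann_ge0.
rewrite ge0_integral_sum//.
- by move=> i; apply: measurable_conv_section => //; exact: measurable_neumann.
- by move=> i s _; rewrite mule_ge0 ?lee_fin// neumann_ge0.
Qed.

(** All terms are nonnegative, so sum and integral may be exchanged without any finiteness; the
    identity holds at every time, including those where both sides are infinite. *)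
Lemma majorantE t : majorant t = (g t)%:E + conv k majorant t.
Proof.
rewrite {1}/majorant nneseries_recl//; last by move=> i _; exact: neumann_ge0.
congr (_ + _).
rewrite -nneseries_addn; last by move=> i; exact: neumann_ge0.
transitivity (\int[mu]_s (\sum_(0 <= i <oo) ((k (t - s))%:E * neumann i s))); last first.
  by apply: eq_integral => s _; rewrite nneseriesZl// => i _; exact: neumann_ge0.
rewrite integral_nneseries//.
- by apply: eq_eseriesr => i _; rewrite addn1.
- by move=> i; apply: measurable_conv_section => //; exact: measurable_neumann.
- by move=> i s _; rewrite mule_ge0 ?lee_fin// neumann_ge0.
Qed.

Lemma conv_majorant_le t : conv k majorant t <= majorant t.
Proof. by rewrite [leRHS]majorantE leeDr// lee_fin. Qed.

Let G2 t := majorant t * majorant t.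

(** The bound is the fixed point of W |-> I / (1 - gam) + gam W, so the induction reproduces it
    exactly. *)
Lemma wint_neumann_sum (I : R) m : wint om (fun t => (g t ^+ 2)%:E) <= I%:E ->
  wint om (fun t => neumann_sum m t * neumann_sum m t) <= (I / (1 - gam) ^+ 2)%:E.
Proof.
move=> gI.
have gam1' : (0 < 1 - gam)%R by rewrite subr_gt0; exact: (fk_gam1 kP).
have I0 : (0 <= I)%R.
  rewrite -lee_fin; apply: le_trans gI; apply: (wint_ge0 kP) => t.
  by rewrite lee_fin sqr_ge0.
elim: m => [|m IH].
  rewrite (_ : wint _ _ = 0); first by rewrite lee_fin divr_ge0// sqr_ge0.
  by apply: integral0_eq => t _; rewrite /neumann_sum big_nil !mule0.
under [X in wint _ X]eq_fun do rewrite neumann_sumS.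
apply: (le_trans (wint_add_conv kP g0 mg (neumann_sum_ge0 m) (measurable_neumann_sum m))).
rewrite (_ : I / _ = (1 - gam)^-1 * I + gam * (I / (1 - gam) ^+ 2))%R; last first.
  by field; rewrite gt_eqF.
rewrite EFinD !EFinM leeD// lee_wpmul2l// lee_fin.
  by rewrite invr_ge0 ltW.
exact: (gam_ge0 kP).
Qed.

(** Obtained as a monotone limit of the partial sums: the recursion applied to the majorant itself
    would not exclude an infinite norm. *)
Lemma wint_majorant (I : R) : wint om (fun t => (g t ^+ 2)%:E) <= I%:E ->
  wint om G2 <= (I / (1 - gam) ^+ 2)%:E.
Proof.
move=> gI.
pose F m t := (om t)%:E * (neumann_sum m t * neumann_sum m t).
have om0 := fk_om0 kP.
have limF t : F ^~ t @ \oo --> (om t)%:E * G2 t.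
  (* A product of extended-real limits must not have the form 0 * oo; both factors have the same
     limit here, so that form cannot occur. *)
  apply: cvgeZl => //; apply: cvgeM; [|exact: neumann_sum_cvg..].
  have := majorant_ge0 t; case: (majorant t) => [r _|_|//].
    exact: mule_def_fin.
  exact: mule_def_neq0_infty.
have -> : wint om G2 = \int[mu]_t limn (F ^~ t).
  by apply: eq_integral => t _; apply/esym/cvg_lim => //; exact: limF.
rewrite monotone_convergence//; last 3 first.
- move=> m; apply: (measurable_wint kP); apply: emeasurable_funM;
    exact: measurable_neumann_sum.
- by move=> m t _; rewrite !mule_ge0 ?lee_fin// neumann_sum_ge0.
- move=> t _ a b ab; apply: lee_wpmul2l; first by rewrite lee_fin.
  by apply: ge0_sqr_le; [exact: neumann_sum_ge0|exact: nd_neumann_sum].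
apply: lime_le.
  apply: ereal_nondecreasing_is_cvgn => a b ab; apply: ge0_le_integral => //.
  - by move=> t _; rewrite !mule_ge0 ?lee_fin// neumann_sum_ge0.
  - by apply: (measurable_wint kP); apply: emeasurable_funM;
      exact: measurable_neumann_sum.
  - by apply: (measurable_wint kP); apply: emeasurable_funM;
      exact: measurable_neumann_sum.
  - move=> t _; apply: lee_wpmul2l; first by rewrite lee_fin.
    by apply: ge0_sqr_le; [exact: neumann_sum_ge0|exact: nd_neumann_sum].
by apply: nearW => m; exact: wint_neumann_sum.
Qed.

End neumann.

(** * Vector-valued convolution and Picard iteration *)

Section parameter_integral.
Context {R : realType}.
Local Notation mu := (@lebesgue_measure R).

(** Tonelli's theorem makes the integrals of the positive and negative parts measurable in the
    parameter, and [fine] of their difference stays measurable even where the integral diverges.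
    Hence no integrability is assumed. *)
Lemma measurable_Rintegral_param (F : R * R -> R) : measurable_fun setT F ->
  measurable_fun setT (fun t : R => \int[mu]_s F (t, s)).
Proof.
move=> mF; have mFE : measurable_fun setT (EFin \o F) by exact/measurable_EFinP.
apply: (@measurableT_comp _ _ _ _ _ _ (@fine R) _
  (fun t : R => \int[mu]_s (F (t, s))%:E)%E).
  exact: fine_measurable.
have mp : measurable_fun setT (fun t : R => \int[mu]_s ((EFin \o F)^\+ (t, s)))%E.
  exact: (measurable_fun_fubini_tonelli_F (m2 := mu) _
    (measurable_funepos mFE) (funepos_ge0 _)).
have mn : measurable_fun setT (fun t : R => \int[mu]_s ((EFin \o F)^\- (t, s)))%E.
  exact: (measurable_fun_fubini_tonelli_F (m2 := mu) _
    (measurable_funeneg mFE) (funeneg_ge0 _)).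
rewrite (_ : (fun t => _) = (fun t : R => \int[mu]_s ((EFin \o F)^\+ (t, s)))
    \- (fun t : R => \int[mu]_s ((EFin \o F)^\- (t, s))))%E; last first.
  apply/funext => t; rewrite [LHS]integralE.
  by congr (_ - _)%E; apply: eq_integral => s _; rewrite ?funeposE ?funenegE.
exact: (emeasurable_funB mp mn).
Qed.

End parameter_integral.

Section vector_convolution.
Context {R : realType} {n : nat}.
Local Notation mu := (@lebesgue_measure R).
Variables (kk : R -> 'I_n -> 'I_n -> R) (k : R -> R).
Hypothesis mkk : forall p q, measurable_fun setT (fun t => kk t p q).
Hypothesis mk : measurable_fun setT k.
Hypothesis kkk : forall t v, enorm (mulv (kk t) v) <= k t * enorm v.
Hypothesis k0 : forall t, 0 <= k t.
Implicit Types u v : 'I_n -> R -> R.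

Definition pnorm u (t : R) : \bar R := (enorm (u ^~ t))%:E.

(** Controlled only at times [t] with [conv k (pnorm u) t < +oo]; where an integral diverges it
    merely has a default value. *)
Definition vconv u (p : 'I_n) (t : R) : R :=
  \int[mu]_s mulv (kk (t - s)) (u ^~ s) p.

Lemma pnorm_ge0 u t : (0 <= pnorm u t)%E.
Proof. by rewrite lee_fin enorm_ge0. Qed.

Lemma measurable_pnorm u : (forall p, measurable_fun setT (u p)) ->
  measurable_fun setT (pnorm u).
Proof. by move=> mu_; apply/measurable_EFinP; exact: measurable_enorm. Qed.

Lemma measurable_vconv_section u p (t : R) : (forall p, measurable_fun setT (u p)) ->
  measurable_fun setT (fun s : R => mulv (kk (t - s)) (u ^~ s) p).
Proof.
move=> mu_; apply: measurable_mulv => // i j.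
by apply: (measurableT_comp (mkk i j)); exact: measurable_funB.
Qed.

Lemma measurable_vconv u p : (forall p, measurable_fun setT (u p)) ->
  measurable_fun setT (vconv u p).
Proof.
move=> mu_.
have mA i j : measurable_fun setT (fun z : R * R => kk (z.1 - z.2) i j).
  exact: (measurableT_comp (mkk i j) measurable_sub).
have mf q : measurable_fun setT (fun z : R * R => u q z.2).
  exact: (measurableT_comp (mu_ q) (@measurable_snd _ _ _ _)).
exact: (measurable_Rintegral_param (measurable_mulv p mA mf)).
Qed.

Lemma mulv_le_conv u p (t s : R) :
  (`|(mulv (kk (t - s)) (u ^~ s) p)%:E| <= (k (t - s))%:E * pnorm u s)%E.
Proof.
by rewrite -EFinM lee_fin (le_trans (normr_le_enorm _ _)).
Qed.

Lemma integrable_vconv u p (t : R) : (forall p, measurable_fun setT (u p)) ->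
  (conv k (pnorm u) t < +oo)%E ->
  mu.-integrable setT (EFin \o (fun s : R => mulv (kk (t - s)) (u ^~ s) p)).
Proof.
move=> mu_ ut; have ms := measurable_vconv_section p t mu_.
apply/integrableP; split; first exact/measurable_EFinP.
apply: le_lt_trans ut; apply: ge0_le_integral => //.
- by apply: measurableT_comp => //; exact/measurable_EFinP.
- by apply: measurable_conv_section => //; exact: measurable_pnorm.
- by move=> s _; exact: mulv_le_conv.
Qed.

Lemma vconvB u v p (t : R) :
  (forall p, measurable_fun setT (u p)) -> (forall p, measurable_fun setT (v p)) ->
  (conv k (pnorm u) t < +oo)%E -> (conv k (pnorm v) t < +oo)%E ->
  vconv (fun p s => u p s - v p s) p t = vconv u p t - vconv v p t.
Proof.
move=> mu_ mv ut vt; rewrite /vconv -RintegralB//; last 2 first.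
- exact: integrable_vconv.
- exact: integrable_vconv.
apply: eq_Rintegral => s _.
rewrite (_ : (fun q => _) = fun q => u q s + (- 1) * v q s); last first.
  by apply/funext => q; rewrite mulN1r.
by rewrite mulvD mulvZ mulN1r.
Qed.

(* Test the vector-valued integral against its own value. *)
Lemma enorm_vconv u (t : R) : (forall p, measurable_fun setT (u p)) ->
  (conv k (pnorm u) t < +oo)%E ->
  ((enorm (fun p => vconv u p t))%:E <= conv k (pnorm u) t)%E.
Proof.
move=> mu_ ut; set x := fun p => vconv u p t.
have [->|x0] := eqVneq (enorm x) 0.
  by apply: conv_ge0 => // s; exact: pnorm_ge0.
have x_gt0 : 0 < enorm x by rewrite lt_neqAle eq_sym x0 enorm_ge0.
(* After multiplication by |x| > 0 the left side becomes x . x, which is the integral of the scalar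
   products of x with the integrand. *)
rewrite -(@lee_pmul2l _ (enorm x)%:E)// -EFinM -expr2 sqr_enorm.
pose f (p : 'I_n) := (fun s : R => (x p)%:E * (mulv (kk (t - s)) (u ^~ s) p)%:E)%E.
have intf p : mu.-integrable setT (f p).
  by apply: integrableZl => //; exact: integrable_vconv.
have -> : ((\sum_p x p ^+ 2)%:E = \int[mu]_s (\sum_p f p s))%E.
  rewrite integral_sum// -sumEFin; apply: eq_bigr => p _.
  rewrite expr2 EFinM integralZl//; last exact: integrable_vconv.
  congr (_ * _)%E; rewrite /x /vconv /Rintegral fineK//.
  by apply: integrable_fin_num => //; exact: integrable_vconv.
have mpn := measurable_pnorm mu_.
rewrite -ge0_integralZl//; last 3 first.
- exact: measurable_conv_section.
- by move=> s _; rewrite mule_ge0 ?lee_fin ?k0// enorm_ge0.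
- by rewrite lee_fin enorm_ge0.
have mks := measurable_conv_section t mk mpn.
apply: le_integral => //.
- exact: integrable_sum.
- apply: integrableZl => //; apply/integrableP; split => //.
  apply: le_lt_trans ut; rewrite le_eqVlt; apply/orP; left; apply/eqP.
  by apply: eq_integral => s _; rewrite gee0_abs// mule_ge0 ?lee_fin ?k0// enorm_ge0.
- move=> s _; rewrite /f; under eq_bigr do rewrite -EFinM.
  rewrite sumEFin -!EFinM lee_fin.
  by rewrite (le_trans (cauchy_schwarz _ _))// ler_wpM2l ?enorm_ge0.
Qed.

End vector_convolution.

Section picard.
Context {R : realType} {n : nat}.
Local Notation mu := (@lebesgue_measure R).
Variables (k kap om : R -> R) (gam : R).
Hypothesis kP : fading_kernel k kap om gam.
Variable kk : R -> 'I_n -> 'I_n -> R.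
Hypothesis mkk : forall p q, measurable_fun setT (fun t => kk t p q).
Hypothesis kkk : forall t v, enorm (mulv (kk t) v) <= k t * enorm v.
Variable h : 'I_n -> R -> R.
Hypothesis mh : forall p, measurable_fun setT (h p).

Let g (t : R) : R := enorm (h ^~ t).
Let G : R -> \bar R := majorant k g.
Let k0 : forall t, 0 <= k t := fk_k0 kP.
Let mk : measurable_fun setT k := fk_mk kP.
Let g0 t : 0 <= g t. Proof. exact: enorm_ge0. Qed.
Let mg : measurable_fun setT g. Proof. exact: measurable_enorm. Qed.

(* Iterates are set to 0 where the majorant is infinite, so that all estimates
   hold at every point and not merely almost everywhere. *)
Fixpoint picard (m : nat) (p : 'I_n) (t : R) : R :=
  if m is m'.+1 then
    if (G t < +oo)%E then h p t + vconv kk (picard m') p t else 0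
  else 0.

Lemma measurable_picard m p : measurable_fun setT (picard m p).
Proof.
elim: m p => [|m IH] p; first exact: measurable_cst.
apply: measurable_fun_ifT => //.
- apply: (measurable_fun_bool true); rewrite setTI.
  rewrite (_ : _ @^-1` _ = setT `&` [set t | (G t < +oo)%E]).
    apply: emeasurable_fun_infty_o => //; exact: (measurable_majorant kP).
  by rewrite setTI.
- by apply: measurable_funD => //; exact: measurable_vconv.
Qed.

Lemma picard_bad m p t : ~~ (G t < +oo)%E -> picard m p t = 0.
Proof. by case: m => //= m /negbTE->. Qed.

Lemma le_enormB (x y : 'I_n -> R) :
  enorm x <= enorm y + enorm (fun p => x p - y p).
Proof.
rewrite -{1}(_ : (fun p => y p + (x p - y p)) = x); first exact: enormD.
by apply/funext => p; rewrite addrC subrK.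
Qed.

(** From |u| <= G follows k * |u| <= k * G <= G at the same time t. This keeps all convolutions of
    the iteration convergent wherever the majorant is finite. *)
Lemma conv_le_majorant (u : 'I_n -> R -> R) t :
  (forall p, measurable_fun setT (u p)) ->
  (forall s, pnorm u s <= G s)%E ->
  (G t < +oo)%E -> (conv k (pnorm u) t < +oo)%E.
Proof.
move=> mu_ uG; apply: le_lt_trans.
apply: le_trans (conv_majorant_le kP g0 mg t).
apply: le_conv => //.
- by move=> s; exact: pnorm_ge0.
- exact: measurable_pnorm.
- exact: (measurable_majorant kP).
Qed.

(** The two bounds need each other: the increment bound yields the next partial-sum bound, and the
    partial-sum bounds make the convolutions converge, so that the next increment is the convolution
    of the previous one. *)
Lemma picard_bounds m :
  (forall t, pnorm (picard m) t <= neumann_sum k g m t)%E /\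
  (forall t, pnorm (fun p s => (picard m.+1 p s - picard m p s)%R) t <=
    neumann k g m t)%E.
Proof.
elim: m => [|m [IH1 IH2]].
  have V0 p t : vconv kk (fun _ _ => 0) p t = 0.
    transitivity (\int[mu]_(s in [set: R]) (0 : R)).
      by apply: eq_Rintegral => s _; rewrite mulv0.
    by rewrite Rintegral_cst// mul0r.
  split=> t; first by rewrite /pnorm /neumann_sum big_nil (@enorm_cst0 R n).
  rewrite lee_fin /=; case: (G t < +oo)%E.
    apply: enorm_le => p; rewrite subr0 V0 addr0; exact: lexx.
  rewrite [leLHS](_ : _ = 0) ?g0// -[RHS](@enorm_cst0 R n); congr enorm.
  by apply/funext => p; rewrite subrr.
have B1 t : (pnorm (picard m.+1) t <= neumann_sum k g m.+1 t)%E.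
  apply: (@le_trans _ _ (pnorm (picard m) t +
      pnorm (fun p s => (picard m.+1 p s - picard m p s)%R) t)%E).
    by rewrite -EFinD lee_fin; exact: le_enormB.
  by rewrite /neumann_sum big_nat_recr//= leeD.
split=> // t.
have [Gt|/negP Gt] := boolP (G t < +oo)%E; last first.
  rewrite /pnorm (_ : (fun p => _) = fun=> 0) ?enorm_cst0.
    exact: (neumann_ge0 kP).
  by apply/funext => p; rewrite !picard_bad ?subrr//; apply/negP.
have fin j : (forall t, pnorm (picard j) t <= neumann_sum k g j t)%E ->
    (conv k (pnorm (picard j)) t < +oo)%E.
  move=> bj; apply: conv_le_majorant => //; first exact: measurable_picard.
  by move=> s; apply: (le_trans (bj s)); exact: (neumann_sum_le kP).
have fin0 := fin _ IH1; have fin1 := fin _ B1.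
pose d p s := picard m.+1 p s - picard m p s.
have md p : measurable_fun setT (d p).
  by apply: measurable_funB; exact: measurable_picard.
have mN := measurable_neumann kP g0 mg m.
have dN : (conv k (pnorm d) t <= neumann k g m.+1 t)%E.
  by apply: le_conv => //; [move=> s; exact: pnorm_ge0|exact: measurable_pnorm].
have dfin : (conv k (pnorm d) t < +oo)%E.
  apply: conv_le_majorant => // s; apply: (le_trans (IH2 s)).
  apply: le_trans (neumann_sum_le kP g0 m.+1 s).
  rewrite /neumann_sum big_nat_recr//= leeDr//.
  exact: (neumann_sum_ge0 kP).
apply: le_trans dN; rewrite /pnorm.
rewrite (_ : (fun p => _) = fun p => vconv kk d p t); first exact: enorm_vconv.
apply/funext => p; rewrite /d (vconvB mkk mk kkk)//; try exact: measurable_picard.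
by rewrite /= Gt; ring.
Qed.

Lemma picard_le_majorant m t : (pnorm (picard m) t <= G t)%E.
Proof.
apply: (le_trans ((picard_bounds m).1 t)); exact: (neumann_sum_le kP).
Qed.

Definition picard_lim (p : 'I_n) (t : R) : R := limn (fun m => picard m p t).

(* Adding the partial sums of the majorant makes the iterates nondecreasing. *)
Lemma picard_cvg p t : (fun m => picard m p t) @ \oo --> picard_lim p t.
Proof.
have [Gt|Gt] := boolP (G t < +oo)%E; last first.
  apply: (cvgP (0 : R)); under eq_fun do rewrite picard_bad//.
  exact: cvg_cst.
have Gfin : G t \is a fin_num.
  by rewrite ge0_fin_numE//; exact: (majorant_ge0 kP).
have Sle m := neumann_sum_le kP g0 m t.
have Sfin m : neumann_sum k g m t \is a fin_num.
  rewrite ge0_fin_numE; first exact: (le_lt_trans (Sle m)).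
  exact: (neumann_sum_ge0 kP).
pose S m := fine (neumann_sum k g m t).
have SG m : S m <= fine (G t) by rewrite fine_le.
have ndS : nondecreasing_seq S.
  by move=> a b ab; rewrite fine_le//; exact: (nd_neumann_sum kP).
have cS : cvgn S.
  apply: nondecreasing_is_cvgn => //.
  by exists (fine (G t)) => _ [m _ <-]; exact: SG.
have dS m : `|picard m.+1 p t - picard m p t| <= S m.+1 - S m.
  rewrite /S -fineB// -lee_fin fineK; last by rewrite fin_numB !Sfin.
  apply: (@le_trans _ _ (neumann k g m t)).
    apply: le_trans ((picard_bounds m).2 t); rewrite lee_fin.
    exact: (@normr_le_enorm _ _ (fun p => picard m.+1 p t - picard m p t)).
  by rewrite leeBrDl// [leRHS]/neumann_sum big_nat_recr.
have cuS : cvgn (fun m => picard m p t + S m).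
  apply: nondecreasing_is_cvgn.
    apply/nondecreasing_seqP => m; have := dS m; rewrite ler_norml => /andP[]; lra.
  exists (fine (G t) + fine (G t)) => _ [m _ <-]; rewrite lerD//.
  rewrite (le_trans (ler_norm _))//.
  rewrite (le_trans (normr_le_enorm (fun p => picard m p t) p))//.
  by rewrite -lee_fin fineK//; exact: picard_le_majorant.
rewrite /picard_lim (_ : (fun m => picard m p t) = (fun m => picard m p t + S m) - S).
  exact: is_cvgB.
by apply/funext => m; rewrite !fctE addrK.
Qed.

Lemma measurable_picard_lim p : measurable_fun setT (picard_lim p).
Proof.
apply: (@measurable_fun_cvg _ _ _ _ (fun m => picard m p)) => [m|t _].
  exact: measurable_picard.
exact: picard_cvg.
Qed.

Lemma picard_lim_le_majorant t : (pnorm picard_lim t <= G t)%E.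
Proof.
have [Gt|] := boolP (G t < +oo)%E; last first.
  by rewrite -leNgt leye_eq => /eqP->; rewrite leey.
have Gfin : G t \is a fin_num.
  by rewrite ge0_fin_numE//; exact: (majorant_ge0 kP).
rewrite /pnorm -[G t]fineK// lee_fin.
have c0 : (fun m => \sum_p picard m p t ^+ 2) @ \oo --> \sum_p picard_lim p t ^+ 2.
  apply: cvg_big => [|p _]; first exact: add_continuous.
  exact: (continuous_cvg _ (@exprn_continuous _ 2 _) (@picard_cvg p t)).
have c : (fun m => enorm (fun p => picard m p t)) @ \oo --> enorm (picard_lim ^~ t).
  exact: (continuous_cvg _ (@sqrt_continuous _ _) c0).
rewrite -(cvg_lim _ c)//; apply: limr_le; first exact: (cvgP _ c).
apply: nearW => m; rewrite -lee_fin fineK//; exact: picard_le_majorant.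
Qed.

(** Dominated convergence with k(t - s) G(s), whose integral over s is at most G(t). The truncation
    of the iterates makes them converge at every s, also where G is infinite. *)
Lemma picard_lim_fixpoint p t : (G t < +oo)%E ->
  picard_lim p t = h p t + vconv kk picard_lim p t.
Proof.
move=> Gt.
have c1 : (fun m => picard m.+1 p t) @ \oo --> picard_lim p t.
  by have := @picard_cvg p t; rewrite -cvg_shiftS.
suff c2 : (fun m => picard m.+1 p t) @ \oo --> h p t + vconv kk picard_lim p t.
  by rewrite -(cvg_lim _ c1)// -(cvg_lim _ c2).
rewrite /= Gt; apply: cvgD; first exact: cvg_cst.
have mlim := measurable_picard_lim.
pose f_ m (s : R) := (mulv (kk (t - s)) (fun q => picard m q s) p)%:E.
pose f (s : R) := (mulv (kk (t - s)) (fun q => picard_lim q s) p)%:E.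
have mf_ m : measurable_fun setT (f_ m).
  apply/measurable_EFinP; apply: measurable_vconv_section => // q.
  exact: measurable_picard.
have mf : measurable_fun setT f.
  by apply/measurable_EFinP; exact: measurable_vconv_section.
have mG : measurable_fun setT G by exact: (measurable_majorant kP).
have iG : mu.-integrable setT (fun s : R => (k (t - s))%:E * G s)%E.
  apply/integrableP; split; first exact: measurable_conv_section.
  apply: le_lt_trans Gt; apply: le_trans (conv_majorant_le kP g0 mg t).
  rewrite le_eqVlt; apply/orP; left; apply/eqP.
  apply: eq_integral => s _; rewrite gee0_abs// mule_ge0 ?lee_fin//.
  exact: (majorant_ge0 kP).
have cf : {ae mu, forall s, [set: R] s -> f_ ^~ s @ \oo --> f s}.
  apply: aeW => s _; apply: cvg_EFin; first by apply: nearW.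
  apply: cvg_big => [|q _]; first exact: add_continuous.
  by apply: cvgMl_tmp; exact: picard_cvg.
have fG : {ae mu, forall (s : R) m, [set: R] s ->
    (`|f_ m s| <= (k (t - s))%:E * G s)%E}.
  apply: aeW => s m _; apply: (le_trans (mulv_le_conv kkk _ p t s)).
  by rewrite lee_wpmul2l ?lee_fin//; exact: picard_le_majorant.
have [fint _ cint] := @dominated_convergence _ _ _ mu setT measurableT
  f_ f _ mf_ mf cf iG fG.
have fE : (\int[mu]_s f s)%E = (vconv kk picard_lim p t)%:E.
  by rewrite /vconv /Rintegral fineK//; exact: integrable_fin_num.
by move: cint; rewrite fE => /fine_cvg.
Qed.

End picard.

(** * The Volterra equation in the weighted space *)

Section almost_everywhere.
Context {R : realType}.
Local Notation mu := (@lebesgue_measure R).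
Variable om : R -> R.
Implicit Types P Q S : R -> Prop.

(** Almost everywhere for the measure with density [om], expressed through Lebesgue measure. *)
Definition ae_om P := {ae mu, forall t : R, 0 < om t -> P t}.

Let FF : Filter (almost_everywhere mu) := ae_filter_ringOfSetsType mu.

Lemma ae_omW P : (forall t, 0 < om t -> P t) -> ae_om P.
Proof. by move=> H; apply: aeW. Qed.

Lemma ae_omS P Q : (forall t, 0 < om t -> P t -> Q t) -> ae_om P -> ae_om Q.
Proof.
by move=> PQ; apply: (@filterS _ _ FF) => t Pt omt; exact: PQ (Pt omt).
Qed.

Lemma ae_omS2 P Q S : (forall t, 0 < om t -> P t -> Q t -> S t) ->
  ae_om P -> ae_om Q -> ae_om S.
Proof.
by move=> PQ; apply: (filterS2 FF) => t Pt Qt omt; exact: PQ (Pt omt) (Qt omt).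
Qed.

End almost_everywhere.

(** * Square-integrable vector functions for the weight *)

Section weighted_L2.
Context {R : realType} {n : nat}.
Local Notation mu := (@lebesgue_measure R).
Variable om : R -> R.
Hypothesis om0 : forall t, 0 <= om t.
Hypothesis mom : measurable_fun setT om.
Implicit Types (x y : 'I_n -> R -> R) (F : R -> \bar R).

Definition wL2 x := (forall p, measurable_fun setT (x p)) /\
  (wint om (fun t => (pnorm x t * pnorm x t)%E) < +oo)%E.

Local Notation ae_om := (ae_om om).

Let momE F : measurable_fun setT F ->
  measurable_fun setT (fun t => (om t)%:E * F t)%E.
Proof. by move=> mF; apply: emeasurable_funM => //; exact/measurable_EFinP. Qed.

Lemma wL2_measurable_sqr x : (forall p, measurable_fun setT (x p)) ->
  measurable_fun setT (fun t => pnorm x t * pnorm x t)%E.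
Proof. by move=> mx; apply: emeasurable_funM; exact: measurable_pnorm. Qed.

Lemma le_wint_ae F1 F2 : (forall t, 0 <= F1 t)%E -> (forall t, 0 <= F2 t)%E ->
  measurable_fun setT F1 -> measurable_fun setT F2 ->
  ae_om (fun t => F1 t <= F2 t)%E -> (wint om F1 <= wint om F2)%E.
Proof.
move=> F10 F20 mF1 mF2 F12; apply: ae_ge0_le_integral => //.
- by move=> t _; rewrite mule_ge0// lee_fin.
- exact: momE.
- by move=> t _; rewrite mule_ge0// lee_fin.
- exact: momE.
have : {ae mu, forall t : R, [set: R] t -> ((om t)%:E * F1 t <= (om t)%:E * F2 t)%E}.
  have FF : Filter (almost_everywhere mu) := ae_filter_ringOfSetsType mu.
  move: F12; apply: (@filterS _ _ FF) => t F12 _.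
  have [omt|omt] := ltP 0 (om t); first by rewrite lee_wpmul2l ?lee_fin// F12.
  by have -> : om t = 0; [apply/le_anti; rewrite omt om0|rewrite !mul0e].
exact.
Qed.

Lemma wL2_dominated x F : (forall p, measurable_fun setT (x p)) ->
  (forall t, 0 <= F t)%E -> measurable_fun setT F ->
  (wint om (fun t => F t * F t)%E < +oo)%E ->
  ae_om (fun t => pnorm x t <= F t)%E -> wL2 x.
Proof.
move=> mx F0 mF Foo xF; split=> //; apply: le_lt_trans Foo; apply: le_wint_ae => //.
- by move=> t; rewrite mule_ge0// pnorm_ge0.
- by move=> t; rewrite mule_ge0.
- exact: wL2_measurable_sqr.
- exact: emeasurable_funM.
- by move: xF; apply: ae_omS => t _ xF; apply: ge0_sqr_le => //; exact: pnorm_ge0.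
Qed.

Lemma wL2B x y : wL2 x -> wL2 y -> wL2 (fun p t => x p t - y p t).
Proof.
move=> [mx xoo] [my yoo].
split; first by move=> p; exact: measurable_funB.
have mxx := wL2_measurable_sqr mx; have myy := wL2_measurable_sqr my.
have ge z t : (0 <= (om t)%:E * (@pnorm R n z t * pnorm z t))%E.
  by apply: mule_ge0; [rewrite lee_fin|apply: mule_ge0; exact: pnorm_ge0].
apply: (@le_lt_trans _ _ (\int[mu]_t (2%:E * ((om t)%:E * (pnorm x t * pnorm x t)) +
    2%:E * ((om t)%:E * (pnorm y t * pnorm y t))))%E).
  apply: ge0_le_integral => //.
  - apply: momE; apply: wL2_measurable_sqr => p; exact: measurable_funB.
  - by apply: emeasurable_funD; apply: emeasurable_funM => //; exact: momE.
  - move=> t _; rewrite /pnorm -!EFinM -EFinD lee_fin.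
    have xy : enorm (fun p => x p t - y p t) <= enorm (x ^~ t) + enorm (y ^~ t).
      by rewrite -(enormN (y ^~ t)); exact: enormD.
    have e0 := enorm_ge0 (fun p => x p t - y p t).
    have x0 := enorm_ge0 (x ^~ t); have y0 := enorm_ge0 (y ^~ t).
    move: xy e0 x0 y0; set a := enorm _; set b := enorm _; set c := enorm _.
    move=> ab a0 b0 c0.
    rewrite [leRHS](_ : _ = om t * (2 * (b * b) + 2 * (c * c))); last by ring.
    rewrite ler_wpM2l//; have := sqr_ge0 (b - c); nra.
rewrite ge0_integralD//; first last.
- by apply: emeasurable_funM => //; exact: momE.
- by move=> t _; rewrite mule_ge0.
- by apply: emeasurable_funM => //; exact: momE.
- by move=> t _; rewrite mule_ge0.
rewrite !ge0_integralZl_EFin//; try exact: momE.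
by rewrite lte_add_pinfty// lte_mul_pinfty// ?lee_fin.
Qed.

Lemma integrable_wdot x y : wL2 x -> wL2 y ->
  mu.-integrable setT (fun t => (om t * \sum_p x p t * y p t)%:E).
Proof.
move=> [mx xoo] [my yoo].
have mxx := wL2_measurable_sqr mx; have myy := wL2_measurable_sqr my.
have mz : measurable_fun setT (fun t => (om t * \sum_p x p t * y p t)%:E).
  apply/measurable_EFinP; apply: measurable_funM => //.
  by apply: measurable_sum => p; exact: measurable_funM.
apply/integrableP; split=> //.
have ge z t : (0 <= (om t)%:E * (@pnorm R n z t * pnorm z t))%E.
  by apply: mule_ge0; [rewrite lee_fin|apply: mule_ge0; exact: pnorm_ge0].
apply: (@le_lt_trans _ _ (\int[mu]_t (((om t)%:E * (pnorm x t * pnorm x t)) +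
    ((om t)%:E * (pnorm y t * pnorm y t))))%E).
  apply: ge0_le_integral => //.
  - exact: measurableT_comp.
  - by apply: emeasurable_funD; exact: momE.
  - move=> t _; rewrite /pnorm -!EFinM -EFinD lee_fin normrM ger0_norm//.
    rewrite -mulrDr ler_wpM2l//.
    have := cauchy_schwarz (x ^~ t) (y ^~ t).
    have := cauchy_schwarz (fun p => - x p t) (y ^~ t).
    under eq_bigr do rewrite mulNr.
    rewrite sumrN enormN ler_norml.
    move: (enorm_ge0 (x ^~ t)) (enorm_ge0 (y ^~ t)).
    set a := enorm _; set b := enorm _ => a0 b0 h1 h2.
    have := sqr_ge0 (a - b) => hs; apply/andP; split; nra.
rewrite ge0_integralD//; try exact: momE.
by rewrite lte_add_pinfty.
Qed.

Lemma wint_ae_fin F : (forall t, 0 <= F t)%E -> measurable_fun setT F ->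
  (wint om (fun t => F t * F t)%E < +oo)%E -> ae_om (fun t => F t < +oo)%E.
Proof.
move=> F0 mF Foo.
have i : mu.-integrable setT (fun t => (om t)%:E * (F t * F t))%E.
  apply/integrableP; split; first by apply: momE; exact: emeasurable_funM.
  apply: le_lt_trans Foo; rewrite le_eqVlt; apply/orP; left; apply/eqP.
  by apply: eq_integral => t _; rewrite gee0_abs// !mule_ge0 ?lee_fin.
have ifin : {ae mu, forall t : R, [set: R] t ->
    ((om t)%:E * (F t * F t))%E \is a fin_num} := integrable_ae measurableT i.
have FF : Filter (almost_everywhere mu) := ae_filter_ringOfSetsType mu.
move: ifin; apply: (@filterS _ _ FF) => t /(_ Logic.I) + omt.
have := F0 t; case: (F t) => [r||//] _; first by rewrite ltry.
by rewrite mulyy gt0_muley// lte_fin.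
Qed.

Lemma wL2_eq0 x : wL2 x -> wint om (fun t => (pnorm x t * pnorm x t)%E) = 0%E ->
  ae_om (fun t => forall p, x p t = 0).
Proof.
move=> [mx _] x0.
have m2 := momE (wL2_measurable_sqr mx).
have /(ae_eq_integral_abs mu measurableT m2) i0 : (\int[mu]_t
    `| (om t)%:E * (pnorm x t * pnorm x t) | = 0)%E.
  rewrite -[RHS]x0; apply: eq_integral => t _; rewrite gee0_abs//.
  by apply: mule_ge0; [rewrite lee_fin|apply: mule_ge0; exact: pnorm_ge0].
have ifin : {ae mu, forall t : R, [set: R] t ->
    ((om t)%:E * (pnorm x t * pnorm x t) = 0)%E} := i0.
have FF : Filter (almost_everywhere mu) := ae_filter_ringOfSetsType mu.
move: ifin; apply: (@filterS _ _ FF) => t /(_ Logic.I) /eqP.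
rewrite /pnorm -!EFinM /= eqe => + omt p.
rewrite !mulf_eq0 gt_eqF//= orbb => /eqP/enorm_eq0/(congr1 (fun f => f p)).
exact.
Qed.

End weighted_L2.

(** * Unique solvability of the Volterra equation *)

Section volterra.
Context {R : realType} {n : nat}.
Local Notation mu := (@lebesgue_measure R).
Variables (k kap om : R -> R) (gam : R).
Hypothesis kP : fading_kernel k kap om gam.
Variable kk : R -> 'I_n -> 'I_n -> R.
Hypothesis mkk : forall p q, measurable_fun setT (fun t => kk t p q).
Hypothesis kkk : forall t v, enorm (mulv (kk t) v) <= k t * enorm v.
Let k0 := fk_k0 kP.
Let mk := fk_mk kP.
Let om0 := fk_om0 kP.
Let mom := fk_mom kP.
Implicit Types x u h : 'I_n -> R -> R.

(** Integrated Jensen inequality with zero datum. The factor [gam] for squared norms is cruder than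
    the gam^2 of Young's inequality, but being below 1 it suffices. *)
Lemma wint_conv_pnorm x : (forall p, measurable_fun setT (x p)) ->
  (wint om (fun t => conv k (pnorm x) t * conv k (pnorm x) t) <=
   gam%:E * wint om (fun t => pnorm x t * pnorm x t))%E.
Proof.
move=> mx.
have := @wint_add_conv _ _ _ _ _ kP (fun=> 0) (pnorm x) (fun=> lexx _)
  (measurable_cst _) (pnorm_ge0 x) (measurable_pnorm mx).
under [X in (wint _ X <= _)%E -> _]eq_fun do rewrite add0e.
rewrite (_ : wint om (fun=> (0 ^+ 2)%:E) = 0%E) ?mule0 ?add0e//.
by apply: integral0_eq => t _; rewrite expr0n mule0.
Qed.

Lemma wint_conv_lty x : wL2 om x ->
  (wint om (fun t => conv k (pnorm x) t * conv k (pnorm x) t) < +oo)%E.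
Proof.
move=> [mx xoo]; apply: (le_lt_trans (wint_conv_pnorm mx)).
by rewrite lte_mul_pinfty// lee_fin (gam_ge0 kP).
Qed.

Lemma conv_ae_fin x : wL2 om x -> ae_om om (fun t => conv k (pnorm x) t < +oo)%E.
Proof.
move=> xL; apply: wint_ae_fin => //; last exact: wint_conv_lty.
- by move=> t; apply: conv_ge0 => // s; exact: pnorm_ge0.
- by apply: measurable_conv => //; [exact: pnorm_ge0|exact: (measurable_pnorm xL.1)].
Qed.

Lemma wL2_vconv x : wL2 om x -> wL2 om (vconv kk x).
Proof.
move=> xL; have [mx xoo] := xL.
apply: (@wL2_dominated _ _ _ _ _ _ (conv k (pnorm x))) => //.
- by move=> p; exact: measurable_vconv.
- by move=> t; apply: conv_ge0 => // s; exact: pnorm_ge0.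
- by apply: measurable_conv => //; [exact: pnorm_ge0|exact: measurable_pnorm].
- exact: wint_conv_lty.
- move: (conv_ae_fin xL); apply: ae_omS => t _ xt.
  exact: (enorm_vconv mkk mk kkk k0 mx xt).
Qed.

Lemma volterra_unique0 x : wL2 om x ->
  ae_om om (fun t => pnorm x t <= conv k (pnorm x) t)%E ->
  ae_om om (fun t => forall p, x p t = 0).
Proof.
move=> xL xle; have [mx xoo] := xL; apply: wL2_eq0 => //.
set W := wint _ _.
have W0 : (0 <= W)%E.
  by apply: (wint_ge0 kP) => t; rewrite mule_ge0// pnorm_ge0.
have : (W <= gam%:E * W)%E.
  apply: le_trans (wint_conv_pnorm mx); apply: le_wint_ae => //.
  - by move=> t; rewrite mule_ge0// pnorm_ge0.
  - by move=> t; rewrite mule_ge0//; apply: conv_ge0 => // s; exact: pnorm_ge0.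
  - exact: wL2_measurable_sqr.
  - apply: emeasurable_funM; apply: measurable_conv => //;
      [exact: pnorm_ge0|exact: measurable_pnorm|exact: pnorm_ge0|exact: measurable_pnorm].
  - by move: xle; apply: ae_omS => t _ xt; apply: ge0_sqr_le => //; exact: pnorm_ge0.
(* Square integrability makes W a real number, and then 0 <= W <= gam W with gam < 1 leaves only W =
   0. *)
move: W0 xoo; rewrite -/W; case: W => [r||]//; rewrite lee_fin => r0 _.
rewrite -EFinM lee_fin => rle; congr EFin.
have := fk_gam1 kP; nra.
Qed.

Lemma volterra_unique h x y : wL2 om x -> wL2 om y ->
  ae_om om (fun t => forall p, x p t = h p t + vconv kk x p t) ->
  ae_om om (fun t => forall p, y p t = h p t + vconv kk y p t) ->
  ae_om om (fun t => forall p, x p t = y p t).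
Proof.
move=> xL yL xE yE.
have dL := wL2B om0 mom xL yL.
suff : ae_om om (fun t => forall p, x p t - y p t = 0).
  by apply: ae_omS => t _ H p; apply/eqP; rewrite -subr_eq0 H.
apply: volterra_unique0 => //.
have xf := conv_ae_fin xL; have yf := conv_ae_fin yL; have df := conv_ae_fin dL.
have xyf := ae_omS2 (fun t _ => @conj _ _) xf yf.
have xyE := ae_omS2 (fun t _ => @conj _ _) xE yE.
move: (ae_omS2 (fun t _ => @conj _ _) xyf df) xyE.
apply: ae_omS2 => t _ [[xfin yfin] dfin] [xE' yE'].
apply: le_trans (enorm_vconv mkk mk kkk k0 dL.1 dfin); rewrite lee_fin.
apply: enorm_le => p; rewrite (vconvB mkk mk kkk p xL.1 yL.1 xfin yfin).
by rewrite /= xE' yE' opprD addrACA subrr add0r.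
Qed.

Lemma volterra_exists h (I : R) : (forall p, measurable_fun setT (h p)) ->
  (wint om (fun t => pnorm h t * pnorm h t) <= I%:E)%E ->
  exists u, [/\ forall p, measurable_fun setT (u p),
    (wint om (fun t => pnorm u t * pnorm u t) <= (I / (1 - gam) ^+ 2)%:E)%E &
    ae_om om (fun t => forall p, u p t = h p t + vconv kk u p t)].
Proof.
move=> mh hI.
pose g (t : R) := enorm (h ^~ t).
have mg : measurable_fun setT g by exact: measurable_enorm.
have g0 t : 0 <= g t by exact: enorm_ge0.
have gI : (wint om (fun t => (g t ^+ 2)%:E) <= I%:E)%E.
  by under eq_fun do rewrite expr2 EFinM.
have GI := wint_majorant kP g0 mg gI.
have mG := measurable_majorant kP g0 mg.
have G0 := majorant_ge0 kP g0.
exists (picard_lim k kk h); split.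
- by move=> p; exact: (measurable_picard_lim kP).
- apply: le_trans GI; apply: le_wint_ae => //.
  + by move=> t; rewrite mule_ge0// pnorm_ge0.
  + by move=> t; rewrite mule_ge0.
  + by apply: wL2_measurable_sqr => p; exact: (measurable_picard_lim kP).
  + exact: emeasurable_funM.
  + apply: ae_omW => t _; apply: ge0_sqr_le; first exact: pnorm_ge0.
    exact: (picard_lim_le_majorant kP).
- have : ae_om om (fun t => majorant k g t < +oo)%E.
    by apply: wint_ae_fin => //; rewrite (le_lt_trans GI)// ltry.
  apply: ae_omS => t _ Gt p; exact: (picard_lim_fixpoint kP).
Qed.

End volterra.

(** * Back to strains and stresses *)

Lemma Rintegral_lincomb {R : realType} {n : nat} (f : 'I_n -> R -> R) (c : 'I_n -> R) :
  (forall p, (@lebesgue_measure R).-integrable setT (EFin \o f p)) ->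
  \int[@lebesgue_measure R]_s (\sum_p f p s * c p) =
  \sum_p (\int[@lebesgue_measure R]_s f p s) * c p.
Proof.
move=> fi.
rewrite -[RHS]/(fine (\sum_p (\int[lebesgue_measure]_s f p s) * c p)%:E).
congr fine; rewrite -sumEFin.
transitivity (\int[@lebesgue_measure R]_s (\sum_p (f p s)%:E * (c p)%:E))%E.
  by apply: eq_integral => s _; rewrite -sumEFin.
rewrite integral_sum//; last by move=> p; exact: (integrableZr measurableT (c p) (fi p)).
apply: eq_bigr => p _; rewrite integralZr//; last exact: fi.
by rewrite EFinM /Rintegral fineK//; apply: integrable_fin_num => //; exact: fi.
Qed.

Section coordinates.
Context {R : realType}.
Local Notation mu := (@lebesgue_measure R).
Variables (T : R) (C : op R) (K : R -> op R) (w : R -> R) (gamma : R).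
Hypothesis Csymm : forall x : 'M[R]_3, symm x -> symm (app C x).
Hypothesis Ksymm : forall (t : R) (x : 'M[R]_3), symm x -> symm (app (K t) x).
Hypothesis mK : forall x : 'M[R]_3, symm x ->
  forall i j, measurable_fun setT (fun t => app (K t) x i j).
Hypothesis Kcausal : forall (t : R) (x : 'M[R]_3), t < 0 -> symm x -> app (K t) x = 0.
Hypothesis w0 : forall s : R, 0 <= s -> 0 < w s.
Hypothesis wni : {in `[(0:R), +oo[ &, {homo w : s t /~ s <= t}}.
Hypothesis w01 : w 0 = 1.
Hypothesis wsg : forall s t : R, 0 <= t -> t <= s -> w (s - t) * w t <= w s.
Hypothesis gamma1 : gamma < 1.
Hypothesis Kint :
  (\int[mu]_(tau in `[(0%R : R), +oo[) (opnorm C (K tau) / w tau)%:E <= gamma%:E)%E.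
Context {n : nat}.
Variable b : 'I_n -> 'M[R]_3.
Hypothesis bON : orthonormal_for C b.
Hypothesis bspan : forall x, symm x -> x = \sum_p dot (app C x) (b p) *: b p.

Let bs p : symm (b p). Proof. by case: bON. Qed.

Definition kmx (t : R) : 'I_n -> 'I_n -> R := mxtensor b (K t).
Definition knorm (t : R) : R := if 0 <= t then eopnorm (kmx t) else 0.
(** Constant extension of w to negative arguments: it stays positive and nonincreasing on the whole
    line, so measurability follows from monotonicity. *)
Definition wext (t : R) : R := w (Num.max 0 t).
Definition kweighted (t : R) : R := knorm t * (wext t)^-1.
(** Density of mu, extended by 0 beyond T, so that integrals against mu become integrals over the
    whole line. *)
Definition weight (t : R) : R := if t < T then wext (T - t) else 0.

Lemma wext_gt0 t : 0 < wext t.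
Proof. by apply: w0; rewrite le_max lexx. Qed.

Lemma wextE t : 0 <= t -> wext t = w t.
Proof. by move=> t0; rewrite /wext max_r. Qed.

Lemma wext_ni (s t : R) : s <= t -> wext t <= wext s.
Proof.
move=> st; apply: wni; [by rewrite in_itv/= le_max lexx..|].
by rewrite ge_max !le_max lexx/= st orbT.
Qed.

Lemma wext_le1 t : wext t <= 1.
Proof.
by rewrite -w01; apply: wni; rewrite ?in_itv/= ?andbT ?le_max ?lexx.
Qed.

Lemma measurable_wext : measurable_fun setT wext.
Proof. by apply: nonincreasing_measurable => // s t; exact: wext_ni. Qed.

Lemma measurable_wextV : measurable_fun setT (fun t => (wext t)^-1).
Proof.
apply: nondecreasing_measurable => // s t st.
by rewrite lef_pV2 ?posrE ?wext_gt0// wext_ni.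
Qed.

Lemma measurable_kmx p q : measurable_fun setT (fun t => kmx t p q).
Proof.
apply: measurable_sum => i; apply: measurable_sum => j.
by apply: measurable_funM => //; exact: mK.
Qed.

Lemma kmx_causal t p q : t < 0 -> kmx t p q = 0.
Proof. by move=> t0; rewrite /kmx /mxtensor Kcausal// dot0l. Qed.

Lemma mulv_kmx_causal t v p : t < 0 -> mulv (kmx t) v p = 0.
Proof. by move=> t0; rewrite /mulv big1// => q _; rewrite kmx_causal// mul0r. Qed.

Lemma enorm_kmx t v : enorm (mulv (kmx t) v) <= knorm t * enorm v.
Proof.
rewrite /knorm; case: ifPn => [_|]; first exact: enorm_mulv.
rewrite -ltNge => t0; rewrite mul0r (_ : mulv _ _ = fun=> 0) ?enorm_cst0//.
by apply/funext => p; rewrite mulv_kmx_causal.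
Qed.

Lemma weightE t : t < T -> weight t = w (T - t).
Proof. by move=> tT; rewrite /weight tT wextE// subr_ge0 ltW. Qed.

Lemma weight_gt0 t : t < T -> 0 < weight t.
Proof. by move=> tT; rewrite /weight tT wext_gt0. Qed.

Lemma weight_lt t : 0 < weight t -> t < T.
Proof. by rewrite /weight; case: ifPn => //; rewrite ltxx. Qed.

Lemma fading_knorm : fading_kernel knorm kweighted weight gamma.
Proof.
have k0 t : 0 <= knorm t by rewrite /knorm; case: ifPn => // _; exact: eopnorm_ge0.
have mk : measurable_fun setT knorm.
  apply: measurable_fun_ifT => //; first exact: measurable_fun_ler.
  by apply: measurable_eopnorm => p q; exact: measurable_kmx.
split=> //.
- by move=> t; rewrite mulr_ge0// invr_ge0 ltW// wext_gt0.
- by move=> t; rewrite /weight; case: ifPn => // _; rewrite ltW// wext_gt0.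
- by apply: measurable_funM => //; exact: measurable_wextV.
- apply: measurable_fun_ifT => //; first exact: measurable_fun_ltr.
  by apply: (measurableT_comp measurable_wext); exact: measurable_funB.
- move=> t; rewrite ler_pdivlMr ?wext_gt0//.
  by rewrite ler_piMr// wext_le1.
- apply: le_trans Kint; rewrite [leRHS]integral_mkcond.
  rewrite le_eqVlt; apply/orP; left; apply/eqP; apply: eq_integral => t _.
  rewrite patchE mem_setE in_itv/= andbT /kweighted /knorm.
  case: ifPn => [t0|]; last by rewrite mul0r.
  by rewrite wextE// (opnormE Csymm bON bspan)// => x; exact: Ksymm.
- move=> t s; rewrite {1}/weight; case: ifPn => [tT|_]; last first.
    by rewrite mul0r !mulr_ge0// ?invr_ge0 ?(ltW (wext_gt0 _))//
      /weight; case: ifPn => // _; rewrite ltW// wext_gt0.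
  have [st|st] := leP s t; last first.
    by rewrite /kweighted /knorm ifF ?mulr0 ?mul0r ?mulr0//; apply/negbTE;
      rewrite -ltNge subr_lt0.
  have ts0 : 0 <= t - s by rewrite subr_ge0.
  rewrite /kweighted mulrCA mulrC ler_wpM2l// ler_pdivlMr ?wext_gt0//.
  rewrite weightE ?(le_lt_trans st)// !wextE ?subr_ge0 ?(ltW tT)//.
  (* The elapsed time T - s is split into T - t and t - s. *)
  have := wsg ts0 (lerB (ltW tT) (lexx s)).
  by rewrite (_ : T - s - (t - s) = T - t)//; ring.
Qed.

(** Stress coordinates, cut off at T. A strain x enters through C x, whose stress coordinates are
    the strain coordinates of x, so one function serves both M and N. *)
Definition tcoord (s : R -> 'M[R]_3) (p : 'I_n) (t : R) : R :=
  if t < T then dot (s t) (b p) else 0.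

Lemma measurable_tcoord (s : R -> 'M[R]_3) p :
  (forall i j, measurable_fun `]-oo, T[ (fun t => s t i j)) ->
  measurable_fun setT (tcoord s p).
Proof.
move=> ms; apply: measurable_fun_if => //; first exact: measurable_fun_ltr.
rewrite setTI (_ : _ @^-1` _ = `]-oo, T[%classic).
  by apply: measurable_sum => i; apply: measurable_sum => j; exact: measurable_funM.
by apply/seteqP; split=> t /=; rewrite in_itv.
Qed.

Lemma measurable_app (A : op R) (x : R -> 'M[R]_3) :
  (forall i j, measurable_fun `]-oo, T[ (fun t => x t i j)) ->
  forall i j, measurable_fun `]-oo, T[ (fun t => app A (x t) i j).
Proof.
move=> mx i j.
rewrite (_ : (fun t => _) = fun t => \sum_(k < 3) \sum_(l < 3) A i j k l * x t k l).
  by apply: measurable_sum => k; apply: measurable_sum => l; exact: measurable_funM.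
by apply/funext => t; rewrite mxE.
Qed.

Lemma muint_weight (f F : R -> R) : (forall t, t < T -> f t = F t) ->
  muint T w f = (\int[mu]_t (weight t * F t)%:E)%E.
Proof.
move=> fF; rewrite /muint integral_mkcond; apply: eq_integral => t _.
rewrite patchE mem_setE in_itv/=; case: ifPn => [tT|tT].
  by rewrite fF// weightE// mulrC.
by rewrite /weight (negbTE tT) mul0r.
Qed.

Lemma muint_pnorm (f : R -> R) (x : 'I_n -> R -> R) :
  (forall t, t < T -> f t = enorm (x ^~ t) ^+ 2) ->
  muint T w f = wint weight (fun t => pnorm x t * pnorm x t)%E.
Proof.
move=> fx; rewrite (muint_weight fx); apply: eq_integral => t _.
by rewrite EFinM expr2 EFinM.
Qed.

Lemma muint_dot (x : R -> 'M[R]_3) : (forall t, t < T -> symm (x t)) ->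
  muint T w (fun t => dot (app C (x t)) (x t)) =
  wint weight (fun t => pnorm (tcoord (fun t => app C (x t))) t *
                        pnorm (tcoord (fun t => app C (x t))) t)%E.
Proof.
move=> xs; apply: muint_pnorm => t tT; rewrite (dot_app bspan) ?xs//.
  by congr (enorm _ ^+ 2); apply/funext => p; rewrite /tcoord tT.
exact: xs.
Qed.

Lemma muint_dotN (s : R -> 'M[R]_3) : (forall t, t < T -> symm (s t)) ->
  muint T w (fun t => dot (Cinv C (s t)) (s t)) =
  wint weight (fun t => pnorm (tcoord s) t * pnorm (tcoord s) t)%E.
Proof.
move=> ss; apply: muint_pnorm => t tT; rewrite (dot_Cinv Csymm bON bspan (ss _ tT)).
by congr (enorm _ ^+ 2); apply/funext => p; rewrite /tcoord tT.
Qed.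

Lemma inM_wL2 (x : R -> 'M[R]_3) : inM T w C x ->
  wL2 weight (tcoord (fun t => app C (x t))).
Proof.
move=> [xs mx xoo]; split; last by rewrite -muint_dot.
by move=> p; apply: measurable_tcoord; exact: measurable_app.
Qed.

Lemma inN_wL2 (s : R -> 'M[R]_3) : inN T w C s -> wL2 weight (tcoord s).
Proof.
move=> [ss ms soo]; split; last by rewrite -muint_dotN.
by move=> p; exact: measurable_tcoord.
Qed.

Definition of_coord (u : 'I_n -> R -> R) (t : R) : 'M[R]_3 := \sum_p u p t *: b p.

Lemma tcoord_of_coord (u : 'I_n -> R -> R) p (t : R) :
  tcoord (fun t => app C (of_coord u t)) p t = if t < T then u p t else 0.
Proof. by rewrite /tcoord (coord_sum bON). Qed.

Lemma symm_of_coord (u : 'I_n -> R -> R) (t : R) : symm (of_coord u t).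
Proof. by apply: symm_sum => p; exact: symmZ. Qed.

Lemma inM_of_coord (u : 'I_n -> R -> R) : wL2 weight u -> inM T w C (of_coord u).
Proof.
move=> [mu_ uoo]; split.
- by move=> t _; exact: symm_of_coord.
- move=> i j; apply: measurable_funTS.
  rewrite (_ : (fun t => _) = fun t => \sum_p u p t * b p i j).
    by apply: measurable_sum => p; exact: measurable_funM.
  by apply/funext => t; rewrite summxE; apply: eq_bigr => p _; rewrite mxE.
- rewrite (muint_pnorm (x := u))// => t tT.
  rewrite (dot_app bspan) ?(symm_of_coord u t)//; last exact: symm_of_coord.
  by congr (enorm _ ^+ 2); apply/funext => p; rewrite (coord_sum bON).
Qed.

(** Causality extends the domain from (-oo, t] to the whole line. The sum stays under the integral,
    so the formula holds at every t < T, convergent or not. *)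
Lemma PopE (x : R -> 'M[R]_3) (t : R) i j : (forall t, t < T -> symm (x t)) -> t < T ->
  Pop C K x t i j = \int[mu]_s
    (\sum_p mulv (kmx (t - s)) (tcoord (fun t => app C (x t)) ^~ s) p * b p i j).
Proof.
move=> xs tT; rewrite mxE Rintegral_mkcond; apply: eq_Rintegral => s _.
rewrite patchE mem_setE in_itv/=; case: ifPn => [st|]; last first.
  rewrite -ltNge => ts; rewrite big1// => p _.
  by rewrite mulv_kmx_causal ?subr_lt0// mul0r.
have sT := le_lt_trans st tT.
rewrite (CinvE Csymm bON bspan (Ksymm _ (xs _ sT))) summxE.
apply: eq_bigr => p _; rewrite mxE (app_coord bspan)//; last exact: xs.
by congr (_ * _); apply: eq_bigr => q _; rewrite /tcoord sT.
Qed.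

Lemma measurable_Pop (x : R -> 'M[R]_3) : inM T w C x ->
  forall i j, measurable_fun `]-oo, T[ (fun t => Pop C K x t i j).
Proof.
move=> xM i j; have [xs _ _] := xM; have [me _] := inM_wL2 xM.
pose e := tcoord (fun t => app C (x t)).
pose F (z : R * R) := \sum_p mulv (kmx (z.1 - z.2)) (e ^~ z.2) p * b p i j.
have mF : measurable_fun setT F.
  apply: measurable_sum => p; apply: measurable_funM => //.
  have mA a c : measurable_fun setT (fun z : R * R => kmx (z.1 - z.2) a c).
    exact: (measurableT_comp (measurable_kmx a c) measurable_sub).
  have mf q : measurable_fun setT (fun z : R * R => e q z.2).
    exact: (measurableT_comp (me q) (@measurable_snd _ _ _ _)).
  exact: (measurable_mulv p mA mf).
have := measurable_funTS (D := `]-oo, T[%classic) (measurable_Rintegral_param mF).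
apply: eq_measurable_fun => t; rewrite mem_setE in_itv/= => tT.
by rewrite PopE.
Qed.

(** Only almost everywhere: taking the basis matrices out of the entrywise integrals requires each
    coordinate integral to converge. *)
Lemma tcoord_Pop (x : R -> 'M[R]_3) : inM T w C x ->
  ae_om weight (fun t => forall p, tcoord (fun t => app C (Pop C K x t)) p t =
    vconv kmx (tcoord (fun t => app C (x t))) p t).
Proof.
move=> xM; have eL := inM_wL2 xM; have [xs _ _] := xM.
move: (conv_ae_fin fading_knorm eL); apply: ae_omS => t /weight_lt tT fin p.
rewrite /tcoord tT -/(tcoord _).
rewrite (_ : Pop C K x t = \sum_p vconv kmx (tcoord (fun t => app C (x t))) p t *: b p).
  by rewrite (coord_sum bON).
apply/matrixP => i j; rewrite PopE// summxE Rintegral_lincomb.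
  by apply: eq_bigr => q _; rewrite mxE.
move=> q; apply: (integrable_vconv measurable_kmx (fk_mk fading_knorm) enorm_kmx) => //.
exact: eL.1.
Qed.

Let om0 := fk_om0 fading_knorm.
Let mom := fk_mom fading_knorm.

Lemma wL2_Pop (x : R -> 'M[R]_3) : inM T w C x ->
  wL2 weight (tcoord (fun t => app C (Pop C K x t))).
Proof.
move=> xM; have eL := inM_wL2 xM.
have [mv voo] := wL2_vconv fading_knorm measurable_kmx enorm_kmx eL.
have mP p : measurable_fun setT (tcoord (fun t => app C (Pop C K x t)) p).
  by apply: measurable_tcoord; apply: measurable_app; exact: measurable_Pop.
split=> //; apply: le_lt_trans voo; apply: le_wint_ae => //.
- by move=> t; rewrite mule_ge0// pnorm_ge0.
- by move=> t; rewrite mule_ge0// pnorm_ge0.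
- exact: wL2_measurable_sqr.
- exact: wL2_measurable_sqr.
- move: (tcoord_Pop xM); apply: ae_omS => t _ Pt; apply: ge0_sqr_le.
    exact: pnorm_ge0.
  by rewrite lee_fin; apply: enorm_le => p; rewrite Pt.
Qed.

Lemma Rmuint_dot (s y : R -> 'M[R]_3) : (forall t, t < T -> symm (y t)) ->
  Rmuint T w (fun t => dot (s t) (y t)) =
  \int[mu]_t (weight t * \sum_p tcoord s p t * tcoord (fun t => app C (y t)) p t).
Proof.
move=> ys; congr fine; apply: muint_weight => t tT.
rewrite (dot_coord bspan) ?ys//; last exact: ys.
by apply: eq_bigr => p _; rewrite /tcoord tT.
Qed.

Definition residual (sigma x : R -> 'M[R]_3) (p : 'I_n) (t : R) : R :=
  tcoord (fun t => app C (x t)) p t - tcoord (fun t => app C (Pop C K x t)) p t -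
  tcoord sigma p t.

Lemma wL2_residual (sigma x : R -> 'M[R]_3) : inN T w C sigma -> inM T w C x ->
  wL2 weight (residual sigma x).
Proof.
move=> sN xM; apply: wL2B => //; last exact: inN_wL2.
by apply: wL2B => //; [exact: inM_wL2|exact: wL2_Pop].
Qed.

Lemma aform_residual (sigma x y : R -> 'M[R]_3) :
  inN T w C sigma -> inM T w C x -> inM T w C y ->
  aform T w C K x y - rhs T w sigma y =
  \int[mu]_t (weight t * \sum_p residual sigma x p t * tcoord (fun t => app C (y t)) p t).
Proof.
move=> sN xM yM; have [ys _ _] := yM; have yL := inM_wL2 yM.
have ix := integrable_wdot om0 mom (inM_wL2 xM) yL.
have iP := integrable_wdot om0 mom (wL2_Pop xM) yL.
have iS := integrable_wdot om0 mom (inN_wL2 sN) yL.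
rewrite /aform /Mip /rhs !Rmuint_dot//.
rewrite -RintegralB// -RintegralB//; last exact: (integrableB measurableT ix iP).
apply: eq_Rintegral => t _; rewrite -!mulrBr; congr (_ * _).
by rewrite -!sumrB; apply: eq_bigr => p _; rewrite /residual !mulrBl.
Qed.

(** Existence uses the equivalence from right to left, uniqueness from left to right. *)
Lemma weak_formP (sigma x : R -> 'M[R]_3) : inN T w C sigma -> inM T w C x ->
  (forall y, inM T w C y -> aform T w C K x y = rhs T w sigma y) <->
  ae_om weight (fun t => forall p, tcoord (fun t => app C (x t)) p t =
    tcoord sigma p t + vconv kmx (tcoord (fun t => app C (x t))) p t).
Proof.
move=> sN xM; have rL := wL2_residual sN xM.
have rE : ae_om weight (fun t => forall p, residual sigma x p t = 0) <->
  ae_om weight (fun t => forall p, tcoord (fun t => app C (x t)) p t =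
    tcoord sigma p t + vconv kmx (tcoord (fun t => app C (x t))) p t).
  split=> H; move: (tcoord_Pop xM) H; apply: ae_omS2 => t _ Pt H p; move: (H p);
    rewrite /residual Pt => H'; lra.
rewrite -rE; split=> [weak|r0 y yM]; last first.
  apply/eqP; rewrite -subr_eq0 (aform_residual sN xM yM).
  have yL := inM_wL2 yM.
  rewrite /Rintegral (ae_eq_integral (cst 0%E))//.
  - by rewrite integral0.
  - exact: measurable_int (integrable_wdot om0 mom rL yL).
  - have : {ae mu, forall t : R, [set: R] t -> (weight t *
        \sum_p residual sigma x p t * tcoord (fun t => app C (y t)) p t)%:E = 0%E}.
      apply: (@filterS _ _ (ae_filter_ringOfSetsType mu) _ _ _ r0) => t rt _.
      have [wt|wt] := ltP 0 (weight t).
        by rewrite big1 ?mulr0// => p _; rewrite rt ?mul0r.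
      by rewrite (_ : weight t = 0) ?mul0r//; apply/le_anti; rewrite wt om0.
    exact.
(* The strain with the residual as coordinates is an admissible test function because the residual
   is square integrable. *)
have rM := inM_of_coord rL.
apply: wL2_eq0 => //.
have : \int[mu]_t (weight t * \sum_p residual sigma x p t *
    tcoord (fun t => app C (of_coord (residual sigma x) t)) p t) = 0.
  by rewrite -(aform_residual sN xM rM) weak// subrr.
have rE2 t : weight t * (\sum_p residual sigma x p t *
    tcoord (fun t => app C (of_coord (residual sigma x) t)) p t) =
    weight t * enorm (residual sigma x ^~ t) ^+ 2.
  have [tT|tT] := ltP t T; last by rewrite /weight ltNge tT !mul0r.
  congr (_ * _); rewrite sqr_enorm; apply: eq_bigr => p _.
  by rewrite tcoord_of_coord tT expr2.
under eq_Rintegral do rewrite rE2.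
have [_ roo] := rL.
have wE : wint weight
    (fun t => pnorm (residual sigma x) t * pnorm (residual sigma x) t)%E =
    (\int[mu]_t (weight t * enorm (residual sigma x ^~ t) ^+ 2)%:E)%E.
  by apply: eq_integral => t _; rewrite expr2 !EFinM.
(* [fine] also sends +oo to 0, so the vanishing of the real integral is conclusive only together
   with finiteness of the weighted norm. *)
rewrite /Rintegral -wE => f0; rewrite -[LHS]fineK ?f0//.
rewrite ge0_fin_numE//; apply: (wint_ge0 fading_knorm) => t.
by rewrite mule_ge0// pnorm_ge0.
Qed.


(** For t < T causality removes the times s > t, so values beyond T do not matter. This allows the
    passage from a solution on the whole line to strain coordinates cut off at T. *)
Lemma vconv_kmx_local (u v : 'I_n -> R -> R) p (t : R) : t < T ->
  (forall q s, s < T -> u q s = v q s) -> vconv kmx u p t = vconv kmx v p t.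
Proof.
move=> tT uv; apply: eq_Rintegral => s _; have [st|ts] := leP s t.
  by apply: eq_bigr => q _; rewrite uv// (le_lt_trans st).
by rewrite !mulv_kmx_causal ?subr_lt0.
Qed.

End coordinates.

Theorem theorem3p1 (R : realType) (T : R) (C : op R) (K : R -> op R)
  (w : R -> R) (gamma : R) (sigma : R -> 'M[R]_3) :
  0 < T ->
  (* C in L(E,F) *)
  (forall x : 'M[R]_3, symm x -> symm (app C x)) ->
  (* (i) elastic stability: C^T = C and C > 0 *)
  (forall x y : 'M[R]_3, symm x -> symm y -> dot (app C x) y = dot x (app C y)) ->
  (forall x : 'M[R]_3, symm x -> x != 0 -> 0 < dot (app C x) x) ->
  (* standing assumptions on the kernel K : R -> L(E,F), measurable *)
  (forall (t : R) (x : 'M[R]_3), symm x -> symm (app (K t) x)) ->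
  (forall x : 'M[R]_3, symm x -> forall i j, measurable_fun setT (fun t => app (K t) x i j)) ->
  (forall (t : R) (x : 'M[R]_3), t < 0 -> symm x -> app (K t) x = 0) ->
  (forall (tau : R) (x y : 'M[R]_3), 0 <= tau -> symm x -> symm y ->
     dot (app (K tau) x) y = dot x (app (K tau) y)) ->
  (forall (tau : R) (x : 'M[R]_3), 0 <= tau -> symm x -> 0 <= dot (app (K tau) x) x) ->
  (* (ii) fading memory *)
  (forall s : R, 0 <= s -> 0 < w s) ->
  {within `[(0:R), +oo[, continuous w} ->
  {in `[(0:R), +oo[ &, {homo w : s t /~ s <= t}} ->
  lebesgue_measure.-integrable `[(0:R), +oo[ (fun s => (w s)%:E) ->
  w 0 = 1 ->
  (forall s t : R, 0 <= t -> t <= s -> w (s - t) * w t <= w s) ->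
  gamma < 1 ->
  (\int[lebesgue_measure]_(tau in `[(0%R : R), +oo[) (opnorm C (K tau) / w tau)%:E
     <= gamma%:E)%E ->
  (* (iii) stress regularity *)
  inN T w C sigma ->
  exists eps : R -> 'M[R]_3,
    [/\ inM T w C eps,
        (forall eta, inM T w C eta -> aform T w C K eps eta = rhs T w sigma eta),
        (forall eps', inM T w C eps' ->
           (forall eta, inM T w C eta -> aform T w C K eps' eta = rhs T w sigma eta) ->
           {ae lebesgue_measure, forall t, t \in `]-oo, T[ -> eps' t = eps t}) &
        Mnorm T w C eps <= (1 - gamma)^-1 * Nnorm T w C sigma].
Proof.
move=> _ Csymm Csa Cpos Ksymm mK Kcausal _ _ w0 _ wni _ w01 wsg gamma1 Kint sN.
have [n [b [bON bspan]]] := exists_orthonormal_basis Csa Cpos.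
have kP := fading_knorm T Csymm Ksymm mK w0 wni w01 wsg gamma1 Kint bON bspan.
have mk := measurable_kmx mK bON.
have kk := enorm_kmx Kcausal bON.
have weakP e := weak_formP Csymm Ksymm mK Kcausal w0 wni w01 wsg gamma1 Kint bON bspan
  (x := e) sN.
have [mh hoo] := inN_wL2 Csymm bON bspan sN.
have [ss _ soo] := sN.
have sE := muint_dotN (T := T) w Csymm bON bspan ss.
set h := tcoord T b sigma in mh hoo sE.
pose I := Rmuint T w (fun t => dot (Cinv C (sigma t)) (sigma t)).
have IE : muint T w (fun t => dot (Cinv C (sigma t)) (sigma t)) = I%:E.
  rewrite /I /Rmuint fineK// ge0_fin_numE// sE.
  by apply: (wint_ge0 kP) => t; rewrite mule_ge0// pnorm_ge0.
have hI : (wint (weight T w) (fun t => pnorm h t * pnorm h t) <= I%:E)%E.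
  by rewrite -sE IE.
have [u [mu_ uI uE]] := volterra_exists kP mk kk mh hI.
have uL : wL2 (weight T w) u by split=> //; rewrite (le_lt_trans uI)// ltry.
pose eps := of_coord b u.
have epsM : inM T w C eps by exact: (inM_of_coord bON bspan).
have epsu p t : t < T -> tcoord T b (fun t => app C (eps t)) p t = u p t.
  by move=> tT; rewrite (tcoord_of_coord _ bON) tT.
have epsE : ae_om (weight T w) (fun t => forall p,
    tcoord T b (fun t => app C (eps t)) p t =
    h p t + vconv (kmx K b) (tcoord T b (fun t => app C (eps t))) p t).
  move: uE; apply: ae_omS => t /weight_lt tT uE p.
  by rewrite epsu// uE (vconv_kmx_local Kcausal bON p tT epsu).
exists eps; split => //.
- exact/weakP.
- move=> eps' eps'M /weakP-/(_ eps'M) eps'E.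
  have epsL := inM_wL2 bspan epsM.
  have eps'L := inM_wL2 bspan eps'M.
  have := volterra_unique kP mk kk eps'L epsL eps'E epsE.
  (* The weight is positive at every t < T, so equality of coordinates holds Lebesgue-almost
     everywhere there, and coordinates determine a symmetric strain. *)
  apply: (@filterS _ _ (ae_filter_ringOfSetsType _)) => t H.
  rewrite in_itv/= => tT; have [eps's _ _] := eps'M.
  apply: (symm_coord_inj bspan); [exact: eps's|exact: (symm_of_coord bON)|].
  move=> p; have := H (weight_gt0 w0 tT) p.
  by rewrite /tcoord tT.
- have g0 : 0 < 1 - gamma by rewrite subr_gt0.
  have [_ _ epsoo] := epsM.
  rewrite /Mnorm /Nnorm -/I /Mip.
  have I0 : 0 <= I.
    rewrite -lee_fin -IE sE; apply: (wint_ge0 kP) => t.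
    by rewrite mule_ge0// pnorm_ge0.
  (* The factor is moved under the square root, which reduces the claim to the bound [uI] on squared
     norms. *)
  rewrite -[(1 - gamma)^-1]gtr0_norm ?invr_gt0// -sqrtr_sqr -sqrtrM ?sqr_ge0//.
  apply: ler_wsqrtr; rewrite mulrC exprVn.
  have epsW : muint T w (fun t => dot (app C (eps t)) (eps t)) =
      wint (weight T w) (fun t => pnorm u t * pnorm u t)%E.
    apply: muint_pnorm => // t tT.
    rewrite (dot_app bspan); last exact: (symm_of_coord bON).
    by congr (enorm _ ^+ 2); apply/funext => p; rewrite (coord_sum bON).
  rewrite -lee_fin /Rmuint fineK; first by rewrite epsW.
  rewrite ge0_fin_numE// epsW; apply: (wint_ge0 kP) => t.
  by rewrite mule_ge0// pnorm_ge0.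
Qed.
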